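(* Consider the Poisson model: $X_1,\dots,X_n$ are independent with $X_i\sim\mathrm{Poi}(\theta_i)$, $n\ge2$, and the parameter vector $\theta=(\theta_1,\dots,\theta_n)$ ranges over a set $\Theta\subseteq[0,\infty)^n$. Let $G_n=\frac1n\sum_{i=1}^n\delta_{\theta_i}$ be the empirical distribution of $\theta$. Then for every estimator $\widehat\theta$, $$0\ \le\ \mathrm{TotReg}^{\mathrm{PI}}(\widehat\theta)-\mathrm{TotReg}^{\mathrm{S}}(\widehat\theta)\ \le\ r_n$$ (understood as $\mathrm{TotReg}^{\mathrm{S}}(\widehat\theta)\le\mathrm{TotReg}^{\mathrm{PI}}(\widehat\theta)\le\mathrm{TotReg}^{\mathrm{S}}(\widehat\theta)+r_n$), where: 1. if $\Theta=[0,h]^n$ with $h>0$, then $r_n\le C\min\{h^3,\,(h\log n)^{3/2}\}$ for a universal constant $C$; 2. if $\Theta$ is the set of $\theta$ for which $G_n$ is $s$-subexponential, then $r_n\le C_s\log^3n$ for a constant $C_s$ depending only on $s$; 3. if, for some $p\ge1$ and a constant $C_0>0$, $\Theta$ is the set of $\theta$ with $\int u^p\,G_n(du)\le C_0$, then $r_n\le C\,n^{\frac{3}{2p+1}}(\log n)^{\frac{3(p+1)}{2p+1}}$ for a constant $C$ depending only on $p$ (and the bound $C_0$).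
   Context: An estimator (decision rule) $\widehat\theta$ is a measurable map $X^n=(X_1,\dots,X_n)\mapsto(\widehat\theta_1,\dots,\widehat\theta_n)\in\mathbb{R}^n$, and $\mathrm{MSE}(\theta,\widehat\theta)=\mathbb{E}_\theta[\|\widehat\theta(X^n)-\theta\|^2]$ (Euclidean norm). A rule is separable if $\widehat\theta(X^n)=(f(X_1),\dots,f(X_n))$ for some single measurable function $f$; it is permutation-invariant if $\widehat\theta_{\pi(i)}(X_{\pi(1)},\dots,X_{\pi(n)})=\widehat\theta_i(X_1,\dots,X_n)$ for all $i\in[n]$, $\pi\in S_n$ (in the sense of equivariance: permuting the observations permutes the estimates accordingly). Let $\mathcal{D}^{\mathrm S}\subseteq\mathcal{D}^{\mathrm{PI}}$ denote the two classes. For each $\theta$, the separable oracle $\widehat\theta^{\mathrm S}$ (resp. PI oracle $\widehat\theta^{\mathrm{PI}}$), which may depend on $\theta$, is the minimizer of $\mathrm{MSE}(\theta,\cdot)$ over $\mathcal{D}^{\mathrm S}$ (resp. $\mathcal{D}^{\mathrm{PI}}$). Equivalently, let $\pi\sim\mathrm{Unif}(S_n)$, $\widetilde\theta_i=\theta_{\pi(i)}$, and $X_i$ be drawn independently from the model with parameter $\widetilde\theta_i$ given $\widetilde\theta$; then $\widehat\theta^{\mathrm S}_i=\mathbb{E}[\widetilde\theta_i|X_i]$ and $\widehat\theta^{\mathrm{PI}}_i=\mathbb{E}[\widetilde\theta_i|X^n]$. The total regrets are $$\mathrm{TotReg}^{\mathrm S}(\widehat\theta)=\sup_{\theta\in\Theta}\bigl(\mathrm{MSE}(\theta,\widehat\theta)-\mathrm{MSE}(\theta,\widehat\theta^{\mathrm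 S})\bigr),\qquad \mathrm{TotReg}^{\mathrm{PI}}(\widehat\theta)=\sup_{\theta\in\Theta}\bigl(\mathrm{MSE}(\theta,\widehat\theta)-\mathrm{MSE}(\theta,\widehat\theta^{\mathrm{PI}})\bigr).$$ A distribution $G$ on $[0,\infty)$ is $s$-subexponential ($s>0$) if $G([t,\infty))\le2e^{-t/s}$ for all $t>0$. $\mathrm{Poi}(0)$ is the point mass at $0$. *)

(* Defs.v *)
From HB Require Import structures.
From mathcomp Require Import all_boot all_order all_algebra all_fingroup.
From mathcomp Require Import all_classical all_reals all_analysis.

Set Implicit Arguments.
Unset Strict Implicit.
Unset Printing Implicit Defensive.

Import Order.TTheory GRing.Theory Num.Theory.
Import numFieldNormedType.Exports.

Local Open Scope classical_set_scope.
Local Open Scope ring_scope.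

(* No measurability condition is imposed: the sample space nat^n is discrete,
   so every map is measurable (see [estimator_measurable] below). *)
Definition estimator (R : realType) (n : nat) : Type :=
  n.-tuple nat -> n.-tuple R.

Lemma measurable_tuple_nat (n : nat) (A : set (n.-tuple nat)) : measurable A.
Proof.
have mset1 (x : n.-tuple nat) : measurable [set x].
  have -> : [set x] = \bigcap_(i in [set: 'I_n])
      ((fun y : n.-tuple nat => tnth y i) @^-1` [set tnth x i]).
    apply/seteqP; split => [y -> // |y xy].
    by apply: eq_from_tnth => i; exact: xy.
  apply: fin_bigcap_measurable => // i _.
  by rewrite -[X in measurable X]setTI; exact: measurable_tnth.
by apply: countable_measurable => //; exact: countableP.
Qed.

Lemma estimator_measurable (R : realType) (n : nat) (d : estimator R n) :
  measurable_fun [set: n.-tuple nat] d.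
Proof. by move=> _ B _; exact: measurable_tuple_nat. Qed.

(* Probability that X^n = x when the X_i ~ Poi(theta_i) are independent.
   [poisson_prob 0] is the Dirac mass at 0, whereas the library's
   [poisson_pmf 0] is constantly 1 and must not be used here.  The second argument of
   [poisson_prob] is a dummy: it does not occur in the library's definition. *)
Definition poisson_mass (R : realType) (n : nat)
    (theta : n.-tuple R) (x : n.-tuple nat) : R :=
  \prod_(i < n) fine (poisson_prob (tnth theta i) 0 [set tnth x i]).

Definition sq_dist (R : realType) (n : nat) (u v : n.-tuple R) : R :=
  \sum_(i < n) (tnth u i - tnth v i) ^+ 2.

Definition mse (R : realType) (n : nat)
    (theta : n.-tuple R) (d : estimator R n) : \bar R :=
  \esum_(x in [set: n.-tuple nat])
    (poisson_mass theta x * sq_dist (d x) theta)%:E.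

Definition separable (R : realType) (n : nat) : set (estimator R n) :=
  [set d | exists f : nat -> R,
     forall x, d x = [tuple f (tnth x i) | i < n]].

Definition perm_tuple (T : Type) (n : nat) (s : 'S_n) (x : n.-tuple T) :
  n.-tuple T := [tuple tnth x (s i) | i < n].

Definition perm_invariant (R : realType) (n : nat) : set (estimator R n) :=
  [set d | forall (s : 'S_n) (x : n.-tuple nat),
     d (perm_tuple s x) = perm_tuple s (d x)].

Definition is_oracle (R : realType) (n : nat) (D : set (estimator R n))
    (theta : n.-tuple R) (d : estimator R n) : Prop :=
  D d /\ forall d' : estimator R n, D d' -> (mse theta d <= mse theta d')%E.

(* A minimizer in the class D.  It may fail to be unique on null events, but
   all the minimizers have the same risk.  The first argument of [xget] is a
   junk value, returned only if there is no minimizer; for the two classes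
   above there is one (the posterior mean). *)
Definition oracle (R : realType) (n : nat) (D : set (estimator R n))
    (theta : n.-tuple R) : estimator R n :=
  xget ((fun=> [tuple 0 | i < n]) : estimator R n)
    [set d : estimator R n | is_oracle D theta d].

Definition tot_reg (R : realType) (n : nat) (D : set (estimator R n))
    (Theta : set (n.-tuple R)) (d : estimator R n) : \bar R :=
  ereal_sup
    [set (mse theta d - mse theta (oracle D theta))%E | theta in Theta].

Definition tot_reg_S (R : realType) (n : nat) (Theta : set (n.-tuple R))
  (d : estimator R n) : \bar R := tot_reg (@separable R n) Theta d.

Definition tot_reg_PI (R : realType) (n : nat) (Theta : set (n.-tuple R))
  (d : estimator R n) : \bar R := tot_reg (@perm_invariant R n) Theta d.

Definition nonneg_params (R : realType) (n : nat) : set (n.-tuple R) :=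
  [set theta | forall i, 0 <= tnth theta i].

Definition empirical (R : realType) (n : nat) (theta : n.-tuple R) :
    {measure set (measurableTypeR R) -> \bar R} :=
  mscale (n%:R^-1)%:nng
    (msum (fun k : nat => \d_(nth 0 theta k : measurableTypeR R)) n).

Definition subexponential (R : realType) (s : R)
    (G : {measure set (measurableTypeR R) -> \bar R}) : Prop :=
  forall t : R, 0 < t ->
    (G `[t, +oo[%classic <= (2 * expR (- t / s))%:E)%E.

Definition box_params (R : realType) (n : nat) (h : R) : set (n.-tuple R) :=
  [set theta | forall i, 0 <= tnth theta i <= h].

Definition subexp_params (R : realType) (n : nat) (s : R) :
    set (n.-tuple R) :=
  @nonneg_params R n `&` [set theta | subexponential s (empirical theta)].

Definition moment_params (R : realType) (n : nat) (p C0 : R) :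
    set (n.-tuple R) :=
  @nonneg_params R n `&`
  [set theta |
    (\int[empirical theta]_u ((u : R) `^ p)%:E <= C0%:E)%E].

Definition regret_gap_le (R : realType) (n : nat) (Theta : set (n.-tuple R))
    (r : R) : Prop :=
  forall d : estimator R n,
    (tot_reg_S Theta d <= tot_reg_PI Theta d)%E /\
    (tot_reg_PI Theta d <= tot_reg_S Theta d + r%:E)%E.

(* Main.v *)
Require Import Defs.
From mathcomp Require Import all_boot all_order all_algebra all_fingroup.
From mathcomp Require Import all_classical all_reals all_analysis.
From mathcomp Require Import measurable_realfun.
From mathcomp Require Import ring lra.

Set Implicit Arguments.
Unset Strict Implicit.
Unset Printing Implicit Defensive.

Import Order.TTheory GRing.Theory Num.Theory.
Import numFieldNormedType.Exports.
Local Open Scope classical_set_scope.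
Local Open Scope ring_scope.

(** Let p_j be the Poisson weights of parameter theta_j, F = sum_j p_j, and let
    t_x be the posterior mean of a uniformly chosen coordinate whose observation
    is x; the rule t is the separable oracle.  Separable rules are equivariant
    and both oracles are attained by posterior means ([is_oracle_sep_rule],
    [is_oracle_perm_rule]), which gives the lower inequality.  The upper one
    asks how much an equivariant rule d can gain on t ([regret_gap_le_oracle]).

    Put g_j(X) = d_j(X) - t(X_j), and let a_j(x) be the mean of g_j given
    X_j = x.  The gain is sum_x (2 A_x - Q_x), where
    Q_x = sum_j p_j(x) E(g_j^2 | X_j = x) and
    A_x = sum_j p_j(x) (theta_j - t_x) a_j(x)
        = F(x)^-1 sum_(j,k) p_j(x) p_k(x) (theta_j - theta_k) a_j(x).
    Let b_jk(x,y) be the mean of g_j given X_j = x and X_k = y.  Exchanging the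
    coordinates j and k, equivariance yields b_jk = b_kj.  The coefficient of
    a_j is antisymmetric in (j,k), so a_j(x) may be replaced there by
    a_j(x) - beta_jk with beta_jk = sum_z kappa(z) b_jk(x,z), for any weights
    kappa of total mass 1.  Now a_j(x) is the p_k-mean of b_jk(x,.), so the
    difference is controlled by the p_k-variance of b_jk(x,.), and Bessel's
    inequality for product laws ([bessel_prod]) bounds the sum over k of these
    variances by E(g_j^2 | X_j = x).  Hence A_x^2 <= eps M Q_x as soon as
    (theta_j - theta_k)^2 <= M and eps is the price of estimating a mean under
    p_k through kappa; pairs (j,k) for which this is too expensive are treated
    by the Cauchy-Schwarz inequality alone.  The outcome,
    [equivariant_mse_ge_separable], holds for arbitrary laws on a finite
    alphabet, and the Poisson model is reached by conditioning on all
    observations being at most K and letting K grow ([mse_sep_rule_le]).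

    It remains to choose kappa and the good pairs.
    - For parameters at most h, all pairs are good and M = h^2.  A point mass at
      x has price 1, which is used for the 4h first values of x.  A point mass
      at 0 has price of order min(1,h) h^x / x!, which is summable and serves
      for the other x, and for all x when h <= 1.  The total is of order h^3
      ([gap_budget_cubic]).
    - Since p_theta(x) <= exp(-(sqrt x - sqrt theta)^2), only parameters with
      (sqrt x - sqrt theta)^2 <= 24 log n matter at x, and two of them that are
      at most h have (theta_j - theta_k)^2 of order h log n.  On [x, x + r],
      with r of order sqrt (x / log n), their weights are at least a constant
      times their weight at x; the uniform kappa on that interval has a price of
      order 1/r.  Summing over the x of order at most h gives (h log n)^(3/2).
      Parameters theta_j above the threshold add log n times theta_j
      ([gap_budget_local]).
    The box follows from both bounds, the subexponential class lies in a box of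
    side 2 s log n, and for the moment class the threshold balances the two
    contributions of the second bound. *)

(** * Product laws on a finite alphabet and Bessel's inequality *)

(** Lagrange's identity: the difference of the two sides is half of a double sum
    of squares. *)
Lemma cauchy_schwarz_sum (R : realFieldType) (I : finType) (w u v : I -> R) :
  (forall i, 0 <= w i) ->
  (\sum_i w i * (u i * v i)) ^+ 2 <=
  (\sum_i w i * u i ^+ 2) * (\sum_i w i * v i ^+ 2).
Proof.
move=> w0.
have : 0 <= \sum_i \sum_j w i * w j * (u i * v j - u j * v i) ^+ 2.
  by do 2 (apply: sumr_ge0 => ? _); rewrite mulr_ge0 ?sqr_ge0 ?mulr_ge0.
have -> : \sum_i \sum_j w i * w j * (u i * v j - u j * v i) ^+ 2 =
    (\sum_i w i * u i ^+ 2) * (\sum_i w i * v i ^+ 2) +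
    (\sum_i w i * v i ^+ 2) * (\sum_i w i * u i ^+ 2) -
    2 * ((\sum_i w i * (u i * v i)) * (\sum_i w i * (u i * v i))).
  rewrite !big_distrlr /= mulr_sumr -!big_split /= -sumrB.
  apply: eq_bigr => i _; rewrite mulr_sumr -!big_split /= -sumrB.
  by apply: eq_bigr => j _; ring.
by rewrite expr2 => H; lra.
Qed.

Section product_law.
Variables (R : realFieldType) (I T : finType) (p : I -> T -> R).
Hypothesis p0 : forall i y, 0 <= p i y.
Hypothesis p1 : forall i, \sum_y p i y = 1.

Definition prod_mean (phi : {ffun I -> T} -> R) : R :=
  \sum_(X : {ffun I -> T}) (\prod_i p i (X i)) * phi X.

Definition upd (X : {ffun I -> T}) (k : I) (y : T) : {ffun I -> T} :=
  [ffun i => if i == k then y else X i].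

Lemma upd_same X k y : upd X k y k = y.
Proof. by rewrite ffunE eqxx. Qed.

Lemma upd_other X k y i : i != k -> upd X k y i = X i.
Proof. by rewrite ffunE => /negbTE ->. Qed.

Lemma upd_upd X k y z : upd (upd X k y) k z = upd X k z.
Proof. by apply/ffunP => i; rewrite !ffunE; case: eqP. Qed.

Lemma upd_id X k : upd X k (X k) = X.
Proof. by apply/ffunP => i; rewrite !ffunE; case: eqP => // ->. Qed.

Lemma updC X j k x y : j != k -> upd (upd X j x) k y = upd (upd X k y) j x.
Proof.
move=> jk; apply/ffunP => i; rewrite !ffunE.
by have [->|//] := eqVneq i j; rewrite (negbTE jk).
Qed.

(** Resampling one coordinate leaves the product law unchanged: exchanging X k with
    the fresh value y is an involution that preserves the weight of (X, y). *)
Lemma prod_mean_tower phi k :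
  prod_mean phi = \sum_y p k y * prod_mean (fun X => phi (upd X k y)).
Proof.
pose W (X : {ffun I -> T}) := \prod_(i | i != k) p i (X i).
have WE (X : {ffun I -> T}) : \prod_i p i (X i) = p k (X k) * W X by rewrite (bigD1 k).
have Wupd X y : W (upd X k y) = W X.
  by apply: eq_bigr => i ik; rewrite upd_other.
have -> : \sum_y p k y * prod_mean (fun X => phi (upd X k y)) =
    \sum_(Z : {ffun I -> T} * T)
      p k Z.2 * (p k (Z.1 k) * W Z.1 * phi (upd Z.1 k Z.2)).
  rewrite -(pair_big xpredT xpredT
    (fun (X : {ffun I -> T}) y => p k y * (p k (X k) * W X * phi (upd X k y)))) /=.
  rewrite [RHS]exchange_big /=; apply: eq_bigr => y _.
  by rewrite mulr_sumr; apply: eq_bigr => X _; rewrite WE.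
pose h (Z : {ffun I -> T} * T) := (upd Z.1 k Z.2, Z.1 k).
have hK : involutive h.
  by case=> X y; rewrite /h /= upd_upd upd_same upd_id.
rewrite (reindex_inj (inv_inj hK)) /=.
rewrite -(pair_big xpredT xpredT (fun (X : {ffun I -> T}) y => p k (X k) *
   (p k (upd X k y k) * W (upd X k y) * phi (upd (upd X k y) k (X k))))) /=.
apply: eq_bigr => X _; rewrite WE.
under eq_bigr => y _ do rewrite upd_same Wupd upd_upd upd_id.
rewrite (eq_bigr (fun y => p k (X k) * W X * phi X * p k y)); last first.
  by move=> y _; ring.
by rewrite -mulr_sumr p1 mulr1.
Qed.

Lemma eq_prod_mean phi psi : phi =1 psi -> prod_mean phi = prod_mean psi.
Proof. by move=> e; apply: eq_bigr => X _; rewrite e. Qed.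

Lemma prod_meanD phi psi :
  prod_mean (fun X => phi X + psi X) = prod_mean phi + prod_mean psi.
Proof. by rewrite -big_split /=; apply: eq_bigr => X _; rewrite mulrDr. Qed.

Lemma prod_meanZ c phi : prod_mean (fun X => c * phi X) = c * prod_mean phi.
Proof. by rewrite mulr_sumr; apply: eq_bigr => X _; rewrite mulrCA. Qed.

Lemma prod_mean_sum (J : finType) (phi : J -> {ffun I -> T} -> R) :
  prod_mean (fun X => \sum_j phi j X) = \sum_j prod_mean (phi j).
Proof.
by rewrite exchange_big /=; apply: eq_bigr => X _; rewrite mulr_sumr.
Qed.

Lemma prod_mean_ge0 phi : (forall X, 0 <= phi X) -> 0 <= prod_mean phi.
Proof.
by move=> h; apply: sumr_ge0 => X _; rewrite mulr_ge0 // prodr_ge0.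
Qed.

Lemma prod_mean1 : prod_mean (fun=> 1) = 1.
Proof.
rewrite /prod_mean (eq_bigr (fun X : {ffun I -> T} => \prod_i p i (X i))).
  by rewrite -bigA_distr_bigA /= big1.
by move=> X _; rewrite mulr1.
Qed.

Lemma prod_mean_cst c : prod_mean (fun=> c) = c.
Proof.
transitivity (prod_mean (fun=> c * 1)).
  by apply: eq_prod_mean => X; rewrite mulr1.
by rewrite prod_meanZ prod_mean1 mulr1.
Qed.

(** The functions of a single coordinate, once centred, are orthogonal for
    different coordinates; the left-hand side is the squared norm of the
    projection of [phi] on the space that they span. *)
Lemma bessel_prod phi :
  \sum_k \sum_y p k y *
     (prod_mean (fun X => phi (upd X k y)) - prod_mean phi) ^+ 2 <=
  prod_mean (fun X => phi X ^+ 2).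
Proof.
set c := prod_mean phi.
pose b k y := prod_mean (fun X => phi (upd X k y)) - c.
pose V k := \sum_y p k y * b k y ^+ 2.
have b0 k : \sum_y p k y * b k y = 0.
  rewrite /b; under eq_bigr => y _ do rewrite mulrBr.
  by rewrite sumrB -prod_mean_tower -mulr_suml p1 mul1r subrr.
have cross k l : prod_mean (fun X => b k (X k) * b l (X l)) =
    if k == l then V k else 0.
  rewrite (prod_mean_tower _ k).
  case: eqVneq => [<-|kl].
    apply: eq_bigr => y _; rewrite -[b k y ^+ 2]prod_mean_cst.
    by congr (_ * _); apply: eq_prod_mean => X; rewrite upd_same expr2.
  rewrite (eq_bigr (fun y => p k y * b k y * prod_mean (fun X => b l (X l)))).
    by rewrite -mulr_suml b0 mul0r.
  move=> y _; rewrite -[RHS]mulrA -[b k y * _]prod_meanZ; congr (_ * _).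
  by apply: eq_prod_mean => X; rewrite upd_same upd_other // eq_sym.
have proj k : prod_mean (fun X => phi X * b k (X k)) = V k.
  rewrite (prod_mean_tower _ k).
  transitivity (\sum_y (p k y * b k y) * (b k y + c)).
    apply: eq_bigr => y _; rewrite {2}/b subrK -[RHS]mulrA -[b k y * _]prod_meanZ.
    by congr (_ * _); apply: eq_prod_mean => X; rewrite upd_same mulrC.
  under eq_bigr => y _ do rewrite mulrDr -mulrA -expr2.
  by rewrite big_split /= -mulr_suml b0 mul0r addr0.
have := prod_mean_ge0 (fun X => sqr_ge0 (phi X - \sum_k b k (X k))).
have -> : prod_mean (fun X => (phi X - \sum_k b k (X k)) ^+ 2) =
    prod_mean (fun X => phi X ^+ 2) - \sum_k V k.
  transitivity (prod_mean (fun X => phi X ^+ 2 +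
     ((-2) * (\sum_k phi X * b k (X k)) +
      \sum_k \sum_l b k (X k) * b l (X l)))).
    apply: eq_prod_mean => X.
    by rewrite -mulr_sumr -big_distrlr /=; ring.
  rewrite !prod_meanD prod_meanZ !prod_mean_sum.
  under [X in _ + (_ + X)]eq_bigr => k _.
    rewrite prod_mean_sum (eq_bigr _ (fun l _ => cross k l)).
    rewrite -big_mkcond /= (big_pred1 k); last first.
      by move=> l /=; rewrite eq_sym.
    over.
  by rewrite (eq_bigr _ (fun k _ => proj k)); ring.
by rewrite subr_ge0.
Qed.

End product_law.

(** * Separable against permutation-equivariant rules on a finite alphabet *)

Lemma sum_antisym (R : numDomainType) (I : finType) (f : I -> I -> R) :
  (forall j k, f j k = - f k j) -> \sum_j \sum_k f j k = 0.
Proof.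
move=> fN; set S := LHS.
have : S = - S.
  rewrite {1}/S exchange_big /= /S -sumrN; apply: eq_bigr => j _.
  by rewrite -sumrN; apply: eq_bigr => k _; rewrite fN.
by move/eqP; rewrite -addr_eq0 -mulr2n mulrn_eq0 /= => /eqP.
Qed.

Section separable_vs_equivariant.
Variables (R : realFieldType) (I T : finType) (p : I -> T -> R) (th : I -> R).
Hypothesis p0 : forall i y, 0 <= p i y.
Hypothesis p1 : forall i, \sum_y p i y = 1.

Definition total_mass (x : T) : R := \sum_j p j x.
Definition post_mean (x : T) : R := (\sum_j p j x * th j) / total_mass x.

Lemma total_mass_ge0 x : 0 <= total_mass x.
Proof. exact: sumr_ge0. Qed.

Lemma le_total_mass i x : p i x <= total_mass x.
Proof. by rewrite /total_mass (bigD1 i) //= lerDl sumr_ge0. Qed.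

Lemma post_mean_deviation x j : total_mass x != 0 ->
  th j - post_mean x = (\sum_k p k x * (th j - th k)) / total_mass x.
Proof.
move=> F0; under eq_bigr do rewrite mulrBr.
by rewrite sumrB -mulr_suml mulrBl mulrAC divff // mul1r.
Qed.

Section fixed_observation.
Variables (g : {ffun I -> T} -> I -> R) (x : T) (G : pred I).
Variables (kappa : T -> R) (eps M : R).
Hypothesis g_swap : forall (X : {ffun I -> T}) j k,
  g [ffun i => X (tperm j k i)] k = g X j.
Hypothesis kappa1 : \sum_z kappa z = 1.
Hypothesis eps0 : 0 <= eps.
Hypothesis M0 : 0 <= M.
Hypothesis G_close : forall j k, G j -> G k -> (th j - th k) ^+ 2 <= M.
Hypothesis G_hide : forall k (b : T -> R), G k -> \sum_z p k z * b z = 0 ->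
  p k x * (\sum_z kappa z * b z) ^+ 2 <= eps * \sum_z p k z * b z ^+ 2.

Let F := total_mass x.
Let a j := prod_mean p (fun X => g (upd X j x) j).
Let q j := prod_mean p (fun X => g (upd X j x) j ^+ 2).
Let b j k z := prod_mean p (fun X => g (upd (upd X j x) k z) j).
Let beta j k := \sum_z kappa z * b j k z.
Let good j k := [&& j != k, G j & G k].

(** Contribution at [x] of the pairs for which no cancellation is used. *)
Definition far_pairs : R :=
  (\sum_j \sum_(k | ~~ (G j && G k)) p j x * p k x * (th j - th k) ^+ 2) / F.

(** Transposing the coordinates [j] and [k] turns the configurations that define
    one side into those that define the other. *)
Let b_sym j k z : j != k -> b j k z = b k j z.
Proof.
move=> jk; apply: eq_prod_mean => X.
rewrite -(g_swap _ j k); congr (g _ k); apply/ffunP => i; rewrite !ffunE.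
have [->|ik] := eqVneq i k; first by rewrite tpermR (negbTE jk) eqxx eq_sym (negbTE jk).
have [->|ij] := eqVneq i j; first by rewrite tpermL eqxx.
have -> : tperm j k i = i by rewrite tpermD // eq_sym.
by rewrite (negbTE ik) (negbTE ij).
Qed.

Let F0 : 0 <= F. Proof. exact: total_mass_ge0. Qed.

Lemma far_pairs_ge0 : 0 <= far_pairs.
Proof.
rewrite divr_ge0 //; do 2 (apply: sumr_ge0 => ? _).
by rewrite mulr_ge0 ?sqr_ge0 ?mulr_ge0.
Qed.

Let q0 j : 0 <= q j.
Proof. by apply: prod_mean_ge0 => // X; rewrite sqr_ge0. Qed.

Let a_sqr j : a j ^+ 2 <= q j.
Proof.
have := prod_mean_ge0 p0 (fun X => sqr_ge0 (g (upd X j x) j - a j)).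
have -> : prod_mean p (fun X => (g (upd X j x) j - a j) ^+ 2) =
   prod_mean p (fun X => g (upd X j x) j ^+ 2 +
     ((-2 * a j) * (g (upd X j x) j) + a j ^+ 2)).
  by apply: eq_prod_mean => X; ring.
rewrite !prod_meanD prod_meanZ prod_mean_cst // -/(a j) -/(q j).
nra.
Qed.

(** Antisymmetry allows to subtract [beta j k] from [a j].  The price of the
    difference is a variance under [p k], and these variances sum up by Bessel's
    inequality. *)
Let good_part :
  (\sum_j \sum_k (good j k)%:R * (p j x * p k x) * (th j - th k) * a j) ^+ 2
  <= M * F ^+ 2 * (eps * \sum_j p j x * q j).
Proof.
have -> : \sum_j \sum_k (good j k)%:R * (p j x * p k x) * (th j - th k) * a j =
  \sum_(jk : I * I) (good jk.1 jk.2)%:R * (p jk.1 x * p jk.2 x) *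
     ((th jk.1 - th jk.2) * (a jk.1 - beta jk.1 jk.2)).
  rewrite -(pair_big xpredT xpredT (fun j k => (good j k)%:R *
    (p j x * p k x) * ((th j - th k) * (a j - beta j k)))) /=.
  apply/eqP; rewrite -subr_eq0 -sumrB; apply/eqP.
  under eq_bigr => j _ do rewrite -sumrB.
  apply: sum_antisym => j k; rewrite /good (eq_sym k) (andbC (G k)).
  case: eqVneq => [->|jk] /=; first ring.
  have -> : beta j k = beta k j by apply: eq_bigr => z _; rewrite b_sym.
  ring.
apply: le_trans (cauchy_schwarz_sum _ _ _) _.
  by move=> jk; rewrite mulr_ge0 // mulr_ge0.
apply: ler_pM.
- by apply: sumr_ge0 => jk _; rewrite mulr_ge0 ?sqr_ge0 // mulr_ge0 // mulr_ge0.
- by apply: sumr_ge0 => jk _; rewrite mulr_ge0 ?sqr_ge0 // mulr_ge0 // mulr_ge0.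
- have -> : M * F ^+ 2 = \sum_(jk : I * I) p jk.1 x * p jk.2 x * M.
    rewrite -(pair_big xpredT xpredT (fun j k => p j x * p k x * M)) /=.
    rewrite expr2 {1}/F /total_mass big_distrlr /= mulr_sumr.
    apply: eq_bigr => j _; rewrite mulr_sumr; apply: eq_bigr => k _.
    by rewrite mulrC.
  apply: ler_sum => -[j k] _ /=; rewrite /good.
  have [/and3P[_ Gj Gk]|_] := boolP [&& _, _ & _]; last first.
    by rewrite !mul0r !mulr_ge0.
  rewrite mul1r ler_wpM2l ?mulr_ge0 //; exact: G_close.
- rewrite -(pair_big xpredT xpredT (fun j k => (good j k)%:R *
    (p j x * p k x) * (a j - beta j k) ^+ 2)) /= mulr_sumr.
  apply: ler_sum => j _; rewrite mulrCA.
  apply: (@le_trans _ _ (p j x * (eps * \sum_k \sum_y p k y *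
     (prod_mean p (fun X => g (upd (upd X k y) j x) j) - a j) ^+ 2))); last first.
    rewrite ler_wpM2l // ler_wpM2l //.
    exact: (bessel_prod p0 p1 (fun X => g (upd X j x) j)).
  rewrite !mulr_sumr; apply: ler_sum => k _; rewrite -/(_ * _).
  have V0 : 0 <= \sum_y p k y *
     (prod_mean p (fun X => g (upd (upd X k y) j x) j) - a j) ^+ 2.
    by apply: sumr_ge0 => y _; rewrite mulr_ge0 ?sqr_ge0.
  rewrite /good; have [/and3P[jk Gj Gk]|_] := boolP [&& _, _ & _]; last first.
    by rewrite !mul0r mulr_ge0 // mulr_ge0.
  rewrite mul1r -mulrA ler_wpM2l //.
  have bE y : prod_mean p (fun X => g (upd (upd X k y) j x) j) = b j k y.
    by apply: eq_prod_mean => X; rewrite -(updC _ _ _ jk).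
  under [X in _ <= _ * X]eq_bigr do rewrite bE.
  have -> : (a j - beta j k) ^+ 2 = (\sum_z kappa z * (b j k z - a j)) ^+ 2.
    under eq_bigr do rewrite mulrBr.
    by rewrite sumrB -mulr_suml kappa1 mul1r -sqrrN opprB.
  apply: G_hide => //.
  under eq_bigr do rewrite mulrBr.
  rewrite sumrB -mulr_suml p1 mul1r; apply/eqP; rewrite subr_eq0; apply/eqP.
  rewrite /a (prod_mean_tower p1 _ k); apply: eq_bigr => y _.
  by rewrite -bE.
Qed.

Let bad_part : F != 0 ->
  (\sum_j \sum_k (~~ (G j && G k))%:R * (p j x * p k x) * (th j - th k) * a j)
    ^+ 2 <= (F * far_pairs) * (F * \sum_j p j x * q j).
Proof.
move=> Fn0.
have -> : \sum_j \sum_k (~~ (G j && G k))%:R * (p j x * p k x) *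
    (th j - th k) * a j =
  \sum_(jk : I * I) (~~ (G jk.1 && G jk.2))%:R * (p jk.1 x * p jk.2 x) *
     ((th jk.1 - th jk.2) * a jk.1).
  rewrite -(pair_big xpredT xpredT (fun j k => (~~ (G j && G k))%:R *
    (p j x * p k x) * ((th j - th k) * a j))) /=.
  by apply: eq_bigr => j _; apply: eq_bigr => k _; rewrite -[LHS]mulrA.
have w0 (jk : I * I) : 0 <= (~~ (G jk.1 && G jk.2))%:R * (p jk.1 x * p jk.2 x).
  by rewrite mulr_ge0 // mulr_ge0.
apply: le_trans (cauchy_schwarz_sum _ _ w0) _.
apply: ler_pM.
- by apply: sumr_ge0 => jk _; rewrite mulr_ge0 ?sqr_ge0.
- by apply: sumr_ge0 => jk _; rewrite mulr_ge0 ?sqr_ge0.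
- rewrite /far_pairs mulrC divfK //.
  rewrite -(pair_big xpredT xpredT (fun j k => (~~ (G j && G k))%:R *
    (p j x * p k x) * (th j - th k) ^+ 2)) /=.
  apply: ler_sum => j _; rewrite [leRHS]big_mkcond /=.
  by apply: ler_sum => k _; case: (G j && G k); rewrite ?mul0r ?mul1r.
- rewrite -(pair_big xpredT xpredT (fun j k => (~~ (G j && G k))%:R *
    (p j x * p k x) * a j ^+ 2)) /= mulr_sumr.
  apply: ler_sum => j _; rewrite {1}/F /total_mass mulr_suml.
  apply: ler_sum => k _.
  have pq : 0 <= p k x * (p j x * q j) by rewrite !mulr_ge0.
  case: (_ && _); rewrite ?mul0r // mul1r (mulrC (p j x)) -mulrA.
  by rewrite ler_wpM2l // ler_wpM2l ?a_sqr.
Qed.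

(** Completing the square: Q - 2 A >= - 2 D as soon as A^2 <= 2 D Q. *)
Lemma fixed_observation_bound :
  - (2 * (eps * M + far_pairs)) <=
  \sum_j p j x * prod_mean p (fun X => g (upd X j x) j ^+ 2) -
  2 * \sum_j p j x * ((th j - post_mean x) *
         prod_mean p (fun X => g (upd X j x) j)).
Proof.
rewrite -[leRHS]/(\sum_j p j x * q j -
  2 * \sum_j p j x * ((th j - post_mean x) * a j)).
have B0 := far_pairs_ge0.
have Q0 : 0 <= \sum_j p j x * q j by apply: sumr_ge0 => j _; rewrite mulr_ge0.
have eM0 : 0 <= eps * M by rewrite mulr_ge0.
have [F_eq0|Fn0] := eqVneq F 0.
  have px j : p j x = 0.
    by apply/eqP; rewrite eq_le p0 andbT -F_eq0 le_total_mass.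
  rewrite [X in _ - 2 * X]big1; last by move=> j _; rewrite px mul0r.
  by rewrite mulr0 subr0 (le_trans _ Q0) // oppr_le0 mulr_ge0 // addr_ge0.
have Fp : 0 < F by rewrite lt_neqAle eq_sym Fn0 F0.
set Q := \sum_j p j x * q j in Q0 *.
have := good_part; have := bad_part Fn0; rewrite -/Q.
set A1 := (\sum_j \sum_k (good j k)%:R * _ * _ * _).
set A2 := (\sum_j \sum_k (~~ _)%:R * _ * _ * _).
have -> : \sum_j p j x * ((th j - post_mean x) * a j) = (A1 + A2) / F.
  rewrite /A1 /A2 -big_split /= mulr_suml; apply: eq_bigr => j _.
  rewrite post_mean_deviation // -big_split /=.
  rewrite [LHS]mulrA (mulrA (p j x)) [LHS]mulrAC; congr (_ / _).
  rewrite -mulrA mulr_suml mulr_sumr; apply: eq_bigr => k _.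
  rewrite /good; case: eqVneq => [->|_] /=; first by ring.
  by case: (G j && G k) => /=; ring.
set A := (A1 + A2) / F => bad good'.
have A_sqr : A ^+ 2 <= 2 * (eps * M + far_pairs) * Q.
  rewrite /A exprMn exprVn ler_pdivrMr ?exprn_gt0 //.
  have : (A1 + A2) ^+ 2 <= 2 * (A1 ^+ 2 + A2 ^+ 2).
    by have := sqr_ge0 (A1 - A2); nra.
  by move=> h; apply: le_trans h _; nra.
set D := eps * M + far_pairs in A_sqr *.
have D0 : 0 <= D by rewrite addr_ge0.
have : 2 * A <= Q + 2 * D.
  apply: le_trans (ler_norm _) _.
  rewrite -ler_sqr ?nnegrE ?addr_ge0 ?mulr_ge0 // real_normK ?num_real //.
  by have := sqr_ge0 (Q - 2 * D); nra.
by lra.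
Qed.

End fixed_observation.
(** Expanding the square around the separable rule [post_mean] and conditioning
    on one coordinate reduces the comparison to [fixed_observation_bound] at each
    value [x] of that coordinate. *)
Lemma equivariant_mse_ge_separable (d : {ffun I -> T} -> I -> R)
    (G : T -> pred I) (kappa : T -> T -> R) (eps M : T -> R) :
  (forall (X : {ffun I -> T}) j k, d [ffun i => X (tperm j k i)] k = d X j) ->
  (forall x, \sum_z kappa x z = 1) ->
  (forall x, 0 <= eps x) -> (forall x, 0 <= M x) ->
  (forall x j k, G x j -> G x k -> (th j - th k) ^+ 2 <= M x) ->
  (forall x k (b : T -> R), G x k -> \sum_z p k z * b z = 0 ->
    p k x * (\sum_z kappa x z * b z) ^+ 2 <=
    eps x * \sum_z p k z * b z ^+ 2) ->
  \sum_x \sum_i p i x * (post_mean x - th i) ^+ 2 -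
    \sum_x 2 * (eps x * M x + far_pairs x (G x)) <=
  prod_mean p (fun X => \sum_i (d X i - th i) ^+ 2).
Proof.
move=> d_swap kappa1 eps0 M0 G_close G_hide.
pose g (X : {ffun I -> T}) i := d X i - post_mean (X i).
have g_swap (X : {ffun I -> T}) j k : g [ffun i => X (tperm j k i)] k = g X j.
  by rewrite /g d_swap ffunE tpermR.
have -> : prod_mean p (fun X => \sum_i (d X i - th i) ^+ 2) =
  \sum_x (\sum_i p i x * (post_mean x - th i) ^+ 2 +
   (\sum_i p i x * prod_mean p (fun X => g (upd X i x) i ^+ 2) -
    2 * \sum_i p i x * ((th i - post_mean x) *
          prod_mean p (fun X => g (upd X i x) i)))).
  rewrite prod_mean_sum.
  under [RHS]eq_bigr => x _.
    rewrite (mulr_sumr _ _ _ 2) -sumrB -big_split /=; over.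
  rewrite [RHS]exchange_big /=; apply: eq_bigr => i _.
  rewrite (prod_mean_tower p1 _ i); apply: eq_bigr => x _.
  rewrite (@eq_prod_mean _ _ _ _ _ (fun X => g (upd X i x) i ^+ 2 +
    ((2 * (post_mean x - th i)) * g (upd X i x) i +
      (post_mean x - th i) ^+ 2))); last first.
    by move=> X; rewrite /g upd_same; ring.
  by rewrite prod_meanD prod_meanD prod_meanZ prod_mean_cst //; ring.
rewrite -sumrB; apply: ler_sum => x _; rewrite lerD2l.
apply: (fixed_observation_bound g_swap (kappa1 x)) => //.
  exact: G_close.
by move=> k b; exact: G_hide.
Qed.

End separable_vs_equivariant.

(** * Poisson weights *)

Section poisson_weights.
Variable R : realType.
Implicit Types (th : R) (x K : nat).

(** With 0 ^+ 0 = 1 this is the point mass at 0 when [th = 0]. *)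
Definition pois th x : R := th ^+ x / x`!%:R * expR (- th).

Definition pois_head th K : R := \sum_(x < K.+1) pois th x.

Lemma fact_gt0R x : 0 < x`!%:R :> R.
Proof. by rewrite ltr0n fact_gt0. Qed.

Lemma pois_ge0 th x : 0 <= th -> 0 <= pois th x.
Proof.
by move=> th0; rewrite mulr_ge0 ?expR_ge0 // divr_ge0 ?exprn_ge0.
Qed.

Lemma pois0x th : pois th 0 = expR (- th).
Proof. by rewrite /pois expr0 fact0 divr1 mul1r. Qed.

Lemma fine_poisson_prob th x : 0 <= th ->
  fine (poisson_prob th 0 [set x]) = pois th x.
Proof.
rewrite le_eqVlt => /predU1P[<-|th0]; rewrite /poisson_prob ?ltxx ?th0.
  rewrite diracE /pois oppr0 expR0 mulr1; case: x => [|x].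
    by rewrite mem_set //= expr0 fact0 divr1.
  by rewrite memNset //= expr0n mul0r.
rewrite esum_set1 ?lee_fin ?poisson_pmf_ge0 //= /poisson_pmf th0.
by [].
Qed.

Lemma poisS th x : pois th x.+1 * x.+1%:R = th * pois th x.
Proof.
rewrite /pois factS natrM exprS; field.
by rewrite !gt_eqF ?fact_gt0R // (_ : 1 + x%:R = x.+1%:R) ?ltr0n // -natr1 addrC.
Qed.

Lemma pois_headE th K :
  pois_head th K = series (exp_coeff th) K.+1 * expR (- th).
Proof.
by rewrite /pois_head /series /= big_mkord mulr_suml; apply: eq_bigr => x _.
Qed.

Lemma cvg_pois_head th : pois_head th K @[K --> \oo] --> (1 : R).
Proof.
rewrite -(mulfV (x := expR th)) ?gt_eqF ?expR_gt0 // -expRN.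
under eq_cvg do rewrite pois_headE.
apply: cvgMl.
by have := is_cvg_series_exp_coeff th; rewrite -(cvg_shiftS (series _)).
Qed.

Lemma pois_head_gt0 th K : 0 <= th -> 0 < pois_head th K.
Proof.
move=> th0; rewrite /pois_head big_ord_recl /= pois0x.
by rewrite ltr_wpDr ?expR_gt0 // sumr_ge0 // => i _; rewrite pois_ge0.
Qed.

Lemma pois_head_homo th : 0 <= th ->
  {homo pois_head th : K L / (K <= L)%N >-> K <= L}.
Proof.
move=> th0; apply: homo_leq => //; first exact: le_trans.
by move=> K; rewrite /pois_head [leRHS]big_ord_recr /= lerDl pois_ge0.
Qed.

Lemma pois_head_le1 th K : 0 <= th -> pois_head th K <= 1.
Proof.
move=> th0.
have := @nondecreasing_cvgn_le _ _ (pois_head_homo th0).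
move/(_ (cvgP _ (cvg_pois_head th)) K).
by rewrite (cvg_lim _ (cvg_pois_head th)).
Qed.

Lemma pois_head_near1 (n : nat) (th : 'I_n -> R) (eta : R) : eta < 1 ->
  exists K0, forall K, (K0 <= K)%N -> eta <= \prod_i pois_head (th i) K.
Proof.
move=> eta1.
have : \prod_i pois_head (th i) K @[K --> \oo] --> (\prod_(i < n) 1 : R).
  apply: cvg_big => // [|i _]; last exact: cvg_pois_head.
  by move=> x; apply: mul_continuous.
rewrite big1_eq => /cvgr_ge /(_ _ eta1) [K0 _ h].
by exists K0 => K K0K; apply: h.
Qed.

End poisson_weights.

(** * Sums over boxes of observations *)

Section boxes.
Variables (R : realType) (n : nat).
Implicit Types (f : n.-tuple nat -> R) (K : nat).

Definition of_box K (X : {ffun 'I_n -> 'I_K.+1}) : n.-tuple nat :=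
  [tuple nat_of_ord (X i) | i < n].

Lemma of_box_inj K : injective (@of_box K).
Proof.
move=> X Y XY; apply/ffunP => i; apply: val_inj.
by have /(congr1 (fun t => tnth t i)) := XY; rewrite !tnth_mktuple.
Qed.

Definition box_sum f K : R := \sum_(X : {ffun 'I_n -> 'I_K.+1}) f (of_box X).

Lemma box_sum_le_esum f K : (forall x, 0 <= f x) ->
  ((box_sum f K)%:E <= \esum_(x in [set: n.-tuple nat]) (f x)%:E)%E.
Proof.
move=> f0; apply: esum_ge.
exists [set` [seq of_box X | X <- enum {ffun 'I_n -> 'I_K.+1}]].
  by split => //; exact: finite_seq.
rewrite -fsbig_seq /=; last first.
  by rewrite map_inj_uniq ?enum_uniq //; exact: of_box_inj.
by rewrite big_map big_enum /= sumEFin.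
Qed.

(** Every finite set of observations lies in a box. *)
Lemma esum_le_box_sums f (c : R) : (forall x, 0 <= f x) ->
  (forall K, box_sum f K <= c) ->
  (\esum_(x in [set: n.-tuple nat]) (f x)%:E <= c%:E)%E.
Proof.
move=> f0 fc; apply: ge_ereal_sup => _ [A [finA _] <-].
rewrite fsbig_finite //=.
set s : seq _ := finmap.enum_fset _.
pose K := \max_(x <- s) \max_(i < n) tnth x i.
pose X x : {ffun 'I_n -> 'I_K.+1} := [ffun i => inord (tnth x i)].
have XK x : x \in s -> of_box (X x) = x.
  move=> xs; apply: eq_from_tnth => i; rewrite tnth_mktuple ffunE inordK //.
  rewrite ltnS /K (big_rem x) //= leq_max; apply/orP; left.
  exact: (leq_bigmax_cond (F := fun i => tnth x i)).
rewrite sumEFin lee_fin (le_trans _ (fc K)) //.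
rewrite big_seq_cond (eq_bigr (fun x => f (of_box (X x)))); last first.
  by move=> x /andP[xs _]; rewrite XK.
rewrite -big_seq_cond -(big_map X xpredT (fun Y => f (of_box Y))) /=.
rewrite big_uniq /=; last first.
  rewrite map_inj_in_uniq; first exact: finmap.fset_uniq.
  by move=> x y xs ys Xxy; rewrite -(XK x) // Xxy XK.
rewrite /box_sum big_mkcond /=; apply: ler_sum => Y _.
by case: ifP.
Qed.

End boxes.

(** * Truncating the Poisson model to a finite alphabet *)

(** The weighted mean minimises the weighted sum of squares; this is what makes
    posterior means optimal, for both classes of rules. *)
Lemma weighted_mean_min (R : realFieldType) (I : finType) (w u : I -> R)
    (c : R) :
  (forall i, 0 <= w i) ->
  \sum_i w i * ((\sum_i w i * u i) / (\sum_i w i) - u i) ^+ 2 <=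
  \sum_i w i * (c - u i) ^+ 2.
Proof.
move=> w0; set m := _ / _.
have [W0|Wn0] := eqVneq (\sum_i w i) 0.
  have wi i : w i = 0.
    apply/eqP; rewrite eq_le w0 andbT -W0 (bigD1 i) //= lerDl.
    by apply: sumr_ge0 => j _.
  by apply: ler_sum => i _; rewrite wi !mul0r.
rewrite -subr_ge0 -sumrB.
rewrite (eq_bigr (fun i => (c - m) ^+ 2 * w i + 2 * (c - m) * (w i * m - w i * u i))); last first.
  by move=> i _; ring.
rewrite big_split /= -!mulr_sumr sumrB -mulr_suml /m mulrCA divff // mulr1 subrr mulr0.
by rewrite addr0 mulr_ge0 ?sqr_ge0 ?sumr_ge0.
Qed.

Section truncation.
Variables (R : realType) (n : nat) (theta : n.-tuple R).
Hypothesis theta0 : forall i, 0 <= tnth theta i.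
Let th i := tnth theta i.

(** Law of an observation conditioned to be at most [K]. *)
Definition tpois (K : nat) (i : 'I_n) (x : 'I_K.+1) : R :=
  pois (th i) x / pois_head (th i) K.

Lemma tpois_ge0 K i x : 0 <= @tpois K i x.
Proof. by rewrite divr_ge0 ?pois_ge0 // ltW // pois_head_gt0. Qed.

Lemma tpois_sum1 K i : \sum_x @tpois K i x = 1.
Proof. by rewrite -mulr_suml mulfV // gt_eqF // pois_head_gt0. Qed.

Lemma le_pois_tpois K i (x : 'I_K.+1) : pois (th i) x <= tpois i x.
Proof.
rewrite /tpois ler_pdivlMr ?pois_head_gt0 // ler_piMr ?pois_ge0 //.
exact: pois_head_le1.
Qed.

Lemma poisson_mass_ge0 x : 0 <= poisson_mass theta x.
Proof. by apply: prodr_ge0 => i _; rewrite fine_poisson_prob ?pois_ge0. Qed.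

Lemma sq_dist_ge0 (u v : n.-tuple R) : 0 <= sq_dist u v.
Proof. by apply: sumr_ge0 => i _; rewrite sqr_ge0. Qed.

Lemma loss_ge0 (d : estimator R n) x :
  0 <= poisson_mass theta x * sq_dist (d x) theta.
Proof. by rewrite mulr_ge0 ?poisson_mass_ge0 ?sq_dist_ge0. Qed.

Lemma box_sum_mass K (phi : n.-tuple nat -> R) :
  box_sum (fun x => poisson_mass theta x * phi x) K =
  (\prod_i pois_head (th i) K) *
    prod_mean (@tpois K) (fun X => phi (of_box X)).
Proof.
rewrite /box_sum /prod_mean mulr_sumr; apply: eq_bigr => X _.
rewrite mulrA -big_split /=; congr (_ * _); apply: eq_bigr => i _.
rewrite tnth_mktuple fine_poisson_prob // /tpois mulrC divfK //.
by rewrite gt_eqF // pois_head_gt0.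
Qed.

Lemma box_sum_coordinates K (phi : 'I_n -> nat -> R) :
  box_sum (fun x => poisson_mass theta x * \sum_i phi i (tnth x i)) K =
  (\prod_i pois_head (th i) K) *
    \sum_i \sum_(x < K.+1) tpois i x * phi i x.
Proof.
rewrite box_sum_mass; congr (_ * _).
rewrite prod_mean_sum; apply: eq_bigr => i _.
rewrite (prod_mean_tower (@tpois_sum1 K) _ i); apply: eq_bigr => x _.
congr (_ * _); rewrite -[RHS](prod_mean_cst (@tpois_sum1 K)).
by apply: eq_prod_mean => X; rewrite tnth_mktuple upd_same.
Qed.

Definition coordinatewise (f : nat -> R) : estimator R n :=
  fun x => [tuple f (tnth x i) | i < n].

(** Risk restricted to observations at most [K], each coordinate being truncated
    on its own; the product over the other coordinates is absent. *)
Definition box_risk (f : nat -> R) K : R :=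
  \sum_(x < K.+1) \sum_i pois (th i) x * (f x - th i) ^+ 2.

Definition sep_rule (x : nat) : R :=
  (\sum_i pois (th i) x * th i) / (\sum_i pois (th i) x).

Lemma box_risk_homo f : {homo box_risk f : K L / (K <= L)%N >-> K <= L}.
Proof.
apply: homo_leq => //; first exact: le_trans.
move=> K; rewrite /box_risk [leRHS]big_ord_recr /= lerDl.
by apply: sumr_ge0 => i _; rewrite mulr_ge0 ?sqr_ge0 ?pois_ge0.
Qed.

Lemma sep_rule_min f K : box_risk sep_rule K <= box_risk f K.
Proof.
apply: ler_sum => x _; apply: weighted_mean_min => i; exact: pois_ge0.
Qed.

Lemma box_sum_coordinatewise f K :
  box_sum (fun x => poisson_mass theta x * sq_dist (coordinatewise f x) theta) K
  = (\prod_i pois_head (th i) K) *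
    \sum_i \sum_(x < K.+1) tpois i x * (f x - th i) ^+ 2.
Proof.
rewrite -(box_sum_coordinates K (fun i x => (f x - th i) ^+ 2)).
apply: eq_bigr => X _; congr (_ * _); apply: eq_bigr => i _.
by rewrite !tnth_mktuple.
Qed.

Lemma mse_coordinatewise_le f (c : R) : (forall K, box_risk f K <= c) ->
  (mse theta (coordinatewise f) <= c%:E)%E.
Proof.
move=> fc; apply: esum_le_box_sums => [x|K]; first exact: loss_ge0.
rewrite box_sum_coordinatewise (le_trans _ (fc K)) // /box_risk exchange_big /=.
rewrite mulr_sumr; apply: ler_sum => x _; rewrite mulr_sumr.
apply: ler_sum => i _; rewrite mulrA ler_wpM2r ?sqr_ge0 //.
rewrite (bigD1 i) //= mulrAC [_ * tpois _ _]mulrC /tpois.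
rewrite divfK ?gt_eqF ?pois_head_gt0 //.
rewrite ler_piMr ?pois_ge0 //.
apply: prodr_ile1 => j _; rewrite pois_head_le1 // andbT.
by rewrite ltW // pois_head_gt0.
Qed.

Lemma mse_coordinatewise_ge f K :
  (((\prod_i pois_head (th i) K) * box_risk f K)%:E <=
   mse theta (coordinatewise f))%E.
Proof.
apply: le_trans (box_sum_le_esum K _); last exact: loss_ge0.
rewrite lee_fin box_sum_coordinatewise ler_wpM2l //.
  by apply: prodr_ge0 => i _; rewrite ltW // pois_head_gt0.
rewrite /box_risk exchange_big /=.
by do 2 (apply: ler_sum => ? _); rewrite ler_wpM2r ?sqr_ge0 // le_pois_tpois.
Qed.

(** The probability that all observations are at most [K] tends to 1, so an
    inequality for the conditioned models passes to the limit.  Only these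
    probabilities converge in the proof: [box_risk] is monotone in [K], so an
    excess of one of its values persists for all larger ones. *)
Lemma mse_sep_rule_le (e : \bar R) (r : R) :
  (exists K0, forall K, (K0 <= K)%N ->
    (((\prod_i pois_head (th i) K) * (box_risk sep_rule K - r))%:E <= e)%E) ->
  (mse theta (coordinatewise sep_rule) <= e + r%:E)%E.
Proof.
case: e => [m| |] [K0 hK]; last 2 first.
- by rewrite addye // leey.
- by have := hK _ (leqnn K0).
rewrite -EFinD; apply: mse_coordinatewise_le => K1.
rewrite -lerBlDr leNgt; apply/negP => mlt.
set v := _ - r in mlt.
have risk_ge K : (maxn K0 K1 <= K)%N -> \prod_i pois_head (th i) K * v <= m.
  rewrite geq_max => /andP[K0K K1K]; rewrite -lee_fin.
  apply: le_trans (hK K K0K); rewrite lee_fin ler_wpM2l //.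
    by apply: prodr_ge0 => i _; rewrite ltW // pois_head_gt0.
  by rewrite lerD2r box_risk_homo.
have [v0|v0] := leP v 0.
  have := risk_ge _ (leqnn _); rewrite leNgt => /negP; apply.
  apply: (lt_le_trans mlt); rewrite mulrC ler_niMr //.
  apply: prodr_ile1 => j _; rewrite pois_head_le1 // andbT.
  by rewrite ltW // pois_head_gt0.
(* The midpoint of m / v and 1 leaves the strict inequality eta * v > m. *)
have eta1 : (m / v + 1) / 2 < 1.
  by rewrite ltr_pdivrMr // mul1r -[2]/(1 + 1) ltrD2r ltr_pdivrMr // mul1r.
have [K2 hK2] := pois_head_near1 th eta1.
have := risk_ge _ (leq_maxl (maxn K0 K1) K2).
have := hK2 _ (leq_maxr (maxn K0 K1) K2).
rewrite -(ler_pM2r v0) => h1 /(le_trans h1).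
rewrite mulrAC mulrDl divfK ?gt_eqF // mul1r => h2.
by lra.
Qed.

End truncation.

(** * Oracles and total regrets *)

(** [gap_budget p th r] certifies that no equivariant rule gains more than [r] on
    the separable posterior mean.  At an observation [x] the set [G x] contains
    the good coordinates, [kappa x] the weights of the surrogate mean, and
    [eps x] the price of this surrogate. *)
Definition gap_budget (R : realFieldType) (I T : finType) (p : I -> T -> R)
    (th : I -> R) (r : R) : Prop :=
  exists (G : T -> pred I) (kappa : T -> T -> R) (eps M : T -> R),
  [/\ forall x, \sum_z kappa x z = 1,
      forall x, 0 <= eps x /\ 0 <= M x,
      forall x j k, G x j -> G x k -> (th j - th k) ^+ 2 <= M x,
      forall x k (b : T -> R), G x k -> \sum_z p k z * b z = 0 ->
        p k x * (\sum_z kappa x z * b z) ^+ 2 <=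
        eps x * \sum_z p k z * b z ^+ 2
    & \sum_x 2 * (eps x * M x + far_pairs p th x (G x)) <= r].

Section oracles.
Variables (R : realType) (n : nat).
Implicit Types (theta : n.-tuple R) (d : estimator R n).

(** Conditioning increases every weight, and [sep_rule] is optimal for the original
    weights, so the separable risk of the conditioned model dominates
    [box_risk]. *)
Lemma mse_sep_rule_le_PI theta d (r : R) : nonneg_params theta ->
  perm_invariant d ->
  (exists K0, forall K, (K0 <= K)%N -> gap_budget (tpois theta (K := K)) (tnth theta) r) ->
  (mse theta (coordinatewise (sep_rule theta)) <= mse theta d + r%:E)%E.
Proof.
move=> theta0 dPI [K0 hK]; apply: mse_sep_rule_le => //; exists K0 => K K0K.
have [G [kappa [eps [M [kappa1 /all_and2[eps0 M0] close hide budget]]]]] := hK K K0K.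
apply: le_trans (box_sum_le_esum K _); last by move=> x; exact: loss_ge0.
rewrite lee_fin box_sum_mass // ler_wpM2l //.
  by apply: prodr_ge0 => i _; rewrite ltW // pois_head_gt0.
pose dd (X : {ffun 'I_n -> 'I_K.+1}) i := tnth (d (of_box X)) i.
have dd_swap (X : {ffun 'I_n -> 'I_K.+1}) j k :
    dd [ffun i => X (tperm j k i)] k = dd X j.
  rewrite /dd (_ : of_box _ = perm_tuple (tperm j k) (of_box X)).
    by rewrite dPI tnth_mktuple tpermR.
  by apply: eq_from_tnth => i; rewrite !tnth_mktuple ffunE.
apply: le_trans (equivariant_mse_ge_separable (tpois_ge0 theta0 (K := K))
  (tpois_sum1 theta0 K) dd_swap kappa1 eps0 M0 close hide).
rewrite lerB //; apply: ler_sum => x _.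
apply: (@le_trans _ _ (\sum_i pois (tnth theta i) x *
   (post_mean (tpois theta (K := K)) (tnth theta) x - tnth theta i) ^+ 2)).
  by apply: weighted_mean_min => i; exact: pois_ge0.
by apply: ler_sum => i _; rewrite ler_wpM2r ?sqr_ge0 // le_pois_tpois.
Qed.

Lemma is_oracle_sep_rule theta : nonneg_params theta ->
  is_oracle (@separable R n) theta (coordinatewise (sep_rule theta)).
Proof.
move=> theta0; split; first by exists (sep_rule theta).
move=> d' [f df].
have -> : d' = coordinatewise f by apply/funext => x; rewrite df.
rewrite -[leRHS]adde0; apply: mse_sep_rule_le => //; exists 0%N => K _.
apply: le_trans (mse_coordinatewise_ge theta0 f K).
rewrite lee_fin subr0 ler_wpM2l ?sep_rule_min //.
by apply: prodr_ge0 => i _; rewrite ltW // pois_head_gt0.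
Qed.

Lemma perm_mass theta (s : 'S_n) x :
  poisson_mass (perm_tuple s theta) (perm_tuple s x) = poisson_mass theta x.
Proof.
rewrite /poisson_mass [RHS](reindex_inj (@perm_inj _ s)) /=.
by apply: eq_bigr => i _; rewrite !tnth_mktuple.
Qed.

Lemma perm_sq_dist (s : 'S_n) (u v : n.-tuple R) :
  sq_dist (perm_tuple s u) (perm_tuple s v) = sq_dist u v.
Proof.
rewrite /sq_dist [RHS](reindex_inj (@perm_inj _ s)) /=.
by apply: eq_bigr => i _; rewrite !tnth_mktuple.
Qed.

Lemma perm_tupleM (T : Type) (s t : 'S_n) (x : n.-tuple T) :
  perm_tuple s (perm_tuple t x) = perm_tuple (s * t)%g x.
Proof. by apply: eq_from_tnth => i; rewrite !tnth_mktuple permM. Qed.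

Lemma perm_tuple1 (T : Type) (x : n.-tuple T) : perm_tuple 1%g x = x.
Proof. by apply: eq_from_tnth => i; rewrite !tnth_mktuple perm1. Qed.

Lemma perm_tuple_bij (T : Type) (s : 'S_n) : bijective (@perm_tuple T n s).
Proof.
exists (perm_tuple s^-1%g) => x.
  by rewrite perm_tupleM mulVg perm_tuple1.
by rewrite perm_tupleM mulgV perm_tuple1.
Qed.

(** Permuting observations and parameters together changes nothing, so the risk of
    an equivariant rule is its average over all permutations of the parameter. *)
Lemma mse_perm theta (s : 'S_n) d : perm_invariant d ->
  mse (perm_tuple s theta) d = mse theta d.
Proof.
move=> dPI; rewrite /mse (@reindex_esum _ _ _ setT setT (perm_tuple s)).
  by apply: eq_esum => x _; rewrite perm_mass dPI perm_sq_dist.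
by rewrite setTT_bijective; exact: perm_tuple_bij.
Qed.

(** Posterior mean under the uniform prior on the permutations of [theta]. *)
Definition perm_rule theta : estimator R n := fun x =>
  [tuple (\sum_(s : 'S_n) poisson_mass (perm_tuple s theta) x *
             tnth (perm_tuple s theta) i) /
         (\sum_(s : 'S_n) poisson_mass (perm_tuple s theta) x) | i < n].

Lemma perm_rule_PI theta : perm_invariant (perm_rule theta).
Proof.
move=> s x; apply: eq_from_tnth => i; rewrite !tnth_mktuple.
have massE (t : 'S_n) : poisson_mass (perm_tuple (s * t)%g theta) (perm_tuple s x) =
    poisson_mass (perm_tuple t theta) x.
  by rewrite -perm_tupleM perm_mass.
congr (_ / _); rewrite (reindex_inj (mulgI s)) /=; apply: eq_bigr => t _.
  by rewrite massE !tnth_mktuple permM.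
by rewrite massE.
Qed.

(** For equivariant rules, [#|'S_n|] times the risk is a Bayes risk, which the
    posterior mean minimises pointwise. *)
Lemma is_oracle_perm_rule theta : nonneg_params theta ->
  is_oracle (@perm_invariant R n) theta (perm_rule theta).
Proof.
move=> theta0; split; first exact: perm_rule_PI.
move=> d dPI.
have ptheta0 (s : 'S_n) i : 0 <= tnth (perm_tuple s theta) i.
  by rewrite tnth_mktuple theta0.
have avg d' : perm_invariant d' -> ((#|'S_n|%:R)%:E * mse theta d' =
    \esum_(x in [set: n.-tuple nat]) \sum_(s : 'S_n)
      (poisson_mass (perm_tuple s theta) x *
         sq_dist (d' x) (perm_tuple s theta))%:E)%E.
  move=> d'PI; rewrite esum_sum; last first.
    by move=> x s _ _; rewrite lee_fin; apply: loss_ge0.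
  rewrite mule_natl /enatmul Monoid.iteropE -big_const.
  by apply: eq_big => // s _; rewrite -(mse_perm theta s d'PI).
have card0 : (0 < #|'S_n|)%N by rewrite card_Sn fact_gt0.
rewrite -(@lee_pmul2l _ (#|'S_n|%:R)%:E) ?lte_fin ?ltr0n //.
rewrite !avg //; last exact: perm_rule_PI.
apply: le_esum => x _; rewrite !sumEFin lee_fin.
rewrite /sq_dist.
under eq_bigr do rewrite mulr_sumr.
under [leRHS]eq_bigr do rewrite mulr_sumr.
rewrite exchange_big /= [leRHS]exchange_big /=.
apply: ler_sum => i _; rewrite tnth_mktuple.
by apply: weighted_mean_min => s; apply: poisson_mass_ge0.
Qed.

Lemma oracleP (D : set (estimator R n)) theta d :
  is_oracle D theta d -> is_oracle D theta (oracle D theta).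
Proof. by move=> dO; apply: xgetPex; exists d. Qed.

Lemma tot_reg_S_le_PI (Theta : set (n.-tuple R)) d :
  Theta `<=` @nonneg_params R n ->
  (tot_reg_S Theta d <= tot_reg_PI Theta d)%E.
Proof.
move=> Theta0; apply: ge_ereal_sup => _ [theta Theta_theta <-].
have theta0 := Theta0 _ Theta_theta.
apply: le_trans (ereal_sup_ubound _); last by exists theta.
rewrite leeB //.
have [_ PImin] := oracleP (is_oracle_perm_rule theta0).
have [[f fE] _] := oracleP (is_oracle_sep_rule theta0).
apply: PImin => s x; rewrite !fE.
by apply: eq_from_tnth => i; rewrite !tnth_mktuple.
Qed.

(** The risks of both oracles enter the regrets with the same [mse theta d]; if
    the equivariant oracle has infinite risk the left difference is [-oo], and
    otherwise both oracles have finite risk. *)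
Lemma regret_gap_le_oracle (Theta : set (n.-tuple R)) (r : R) :
  Theta `<=` @nonneg_params R n ->
  (forall theta d, Theta theta -> perm_invariant d ->
    (mse theta (coordinatewise (sep_rule theta)) <= mse theta d + r%:E)%E) ->
  regret_gap_le Theta r.
Proof.
move=> Theta0 gap d; split; first exact: tot_reg_S_le_PI.
apply: ge_ereal_sup => _ [theta Theta_theta <-].
have theta0 := Theta0 _ Theta_theta.
apply: (@le_trans _ _ (mse theta d - mse theta (oracle (@separable R n) theta) + r%:E)%E).
  have [PIPI _] := oracleP (is_oracle_perm_rule theta0).
  have [_ Smin] := oracleP (is_oracle_sep_rule theta0).
  have Sge0 d' : (0 <= mse theta d')%E.
    by apply: esum_ge0 => x _; rewrite lee_fin loss_ge0.
  have := gap _ _ Theta_theta PIPI.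
  have := Smin _ (proj1 (is_oracle_sep_rule theta0)).
  move=> h1 h2; have {h1 h2} := le_trans h1 h2.
  move: (Sge0 (oracle (@separable R n) theta)) (Sge0 d)
    (Sge0 (oracle (@perm_invariant R n) theta)).
  case: (mse theta (oracle _ theta)) => [a| |] //;
  case: (mse theta (oracle _ theta)) => [b| |] //;
  case: (mse theta d) => [c| |] //= _ _ _ ; rewrite ?lee_fin ?leNye //.
  by move=> h; rewrite -?EFinD -?EFinB ?lee_fin; lra.
by rewrite leeD2r // ereal_sup_ubound //; exists theta.
Qed.

End oracles.

(** * The cubic bound *)

Lemma far_pairs_all (R : realFieldType) (I T : finType) (p : I -> T -> R) th x :
  far_pairs p th x xpredT = 0.
Proof. by rewrite /far_pairs big1 ?mul0r // => j _; rewrite big_pred0. Qed.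

Lemma sum_point (R : pzRingType) (T : finType) (z0 : T) (b : T -> R) :
  \sum_z (z == z0)%:R * b z = b z0.
Proof.
rewrite (bigD1 z0) //= eqxx mul1r big1 ?addr0 // => z /negbTE ->.
by rewrite mul0r.
Qed.

(** Price 1 of the surrogate given by the value at [x] itself. *)
Lemma hide_at_self (R : realFieldType) (T : finType) (p b : T -> R) x :
  (forall z, 0 <= p z) -> p x * b x ^+ 2 <= \sum_z p z * b z ^+ 2.
Proof.
move=> p0; rewrite (bigD1 x) //= lerDl.
by apply: sumr_ge0 => z _; rewrite mulr_ge0 ?sqr_ge0.
Qed.

(** For a centred [b] the value at [z0] is, up to sign, an integral over the other
    points, hence the factor [1 - p z0]; it produces the third power of [h] when
    [h] is small. *)
Lemma hide_at_point (R : realFieldType) (T : finType) (p b : T -> R) z0 :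
  (forall z, 0 <= p z) -> \sum_z p z = 1 -> \sum_z p z * b z = 0 ->
  p z0 * b z0 ^+ 2 <= (1 - p z0) * \sum_z p z * b z ^+ 2.
Proof.
move=> p0 p1 pb.
have w0 z : 0 <= (z != z0)%:R * p z by rewrite mulr_ge0.
have sumE (c : T -> R) : \sum_z (z != z0)%:R * p z * c z =
    \sum_z p z * c z - p z0 * c z0.
  rewrite (bigD1 z0 (F := fun z => p z * c z)) //= addrAC subrr add0r.
  rewrite [RHS]big_mkcond; apply: eq_bigr => z _.
  by case: eqP; rewrite ?mul0r ?mul1r.
have := cauchy_schwarz_sum (fun=> 1) b w0.
rewrite !sumE.
under eq_bigr do rewrite mul1r.
under [X in _ <= (X - _) * _]eq_bigr do rewrite expr1n mulr1.
rewrite pb p1 mul1r expr1n mulr1 sub0r.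
set V := \sum_z _; have := p0 z0; nra.
Qed.

Lemma sum_ord_head (R : numDomainType) (K m : nat) (f : nat -> R) :
  (forall x, 0 <= f x) -> \sum_(x < K | (x < m)%N) f x <= \sum_(x < m) f x.
Proof.
move=> f0; have [mK|Km] := leqP m K; first by rewrite (big_ord_widen K).
rewrite (big_ord_widen_cond m (fun x => (x < m)%N) f (ltnW Km)).
rewrite big_mkcond; apply: ler_sum => x _.
by case: ifP.
Qed.

Section exponential_sums.
Variable R : realType.

Lemma tpois_le_double n (th : n.-tuple R) : nonneg_params th ->
  exists K0, forall K, (K0 <= K)%N ->
  forall i (x : 'I_K.+1), tpois th i x <= 2 * pois (tnth th i) x.
Proof.
move=> th0; have [|K0 hK0] := @pois_head_near1 R n (tnth th) 2^-1.
  by rewrite invf_lt1 ?ltr1n.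
exists K0 => K K0K i x; rewrite /tpois ler_pdivrMr ?pois_head_gt0 //.
suff : 2^-1 <= pois_head (tnth th i) K by have := pois_ge0 x (th0 i); nra.
apply: le_trans (hK0 K K0K) _; rewrite (bigD1 i) //= ler_piMr //.
  by rewrite ltW // pois_head_gt0.
apply: prodr_ile1 => j _; rewrite pois_head_le1 // andbT.
by rewrite ltW // pois_head_gt0.
Qed.

Lemma sum_exp_terms (c : R) K : 0 <= c ->
  \sum_(x < K.+1) c ^+ x / x`!%:R <= expR c.
Proof.
move=> c0; have := pois_head_le1 K c0.
by rewrite /pois_head -mulr_suml expRN ler_pdivrMr ?expR_gt0 // mul1r.
Qed.

Lemma expR_half_le2 : expR (2^-1) <= 2 :> R.
Proof.
rewrite -[expR _]invrK -expRN -[leRHS]invrK lef_pV2 ?posrE ?expR_gt0 ?invr_gt0 //.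
apply: le_trans (expR_ge1Dx _).
by lra.
Qed.

(** Comparison with the exponential series of [2 * c]: beyond [X] each term gains
    the factor 2^-X, which is at most exp(-2c). *)
Lemma sum_exp_terms_tail (c : R) K X : 0 <= c -> 4 * c <= X%:R ->
  \sum_(x < K.+1 | (X <= x)%N) c ^+ x / x`!%:R <= 1.
Proof.
move=> c0 cX.
have e2 : expR (2 * c) <= 2 ^+ X.
  apply: le_trans (_ : expR (2^-1 * X%:R) <= _).
    by rewrite ler_expR; lra.
  by rewrite expRM_natr lerXn2r ?nnegrE ?expR_ge0 // expR_half_le2.
apply: (@le_trans _ _ (\sum_(x < K.+1) (2 ^+ X)^-1 * ((2 * c) ^+ x / x`!%:R))).
  rewrite big_mkcond /=; apply: ler_sum => x _; case: ifPn => [Xx|_]; last first.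
    by rewrite mulr_ge0 ?invr_ge0 ?exprn_ge0 // divr_ge0 ?exprn_ge0 // mulr_ge0.
  rewrite exprMn mulrA ler_wpM2r ?invr_ge0 //.
  rewrite mulrA ler_peMl ?exprn_ge0 //.
  by rewrite ler_pdivlMl ?exprn_gt0 // mulr1 ler_weXn2l ?ler1n.
rewrite -mulr_sumr ler_pdivrMl ?exprn_gt0 // mulr1.
by apply: le_trans (sum_exp_terms K _) e2; rewrite mulr_ge0.
Qed.

End exponential_sums.

Section cubic_budget.
Variables (R : realType) (n : nat) (theta : n.-tuple R) (h : R).
Hypothesis theta_h : box_params h theta.

Let theta0 : nonneg_params theta.
Proof. by move=> i; have /andP[] := theta_h i. Qed.

(** Price of the surrogate given by the value at 0.  The large factor
    1 / p(0) = exp(theta) is compensated by the weight of [x]. *)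
Lemma hide_at_zero K (x : 'I_K.+1) k (b : 'I_K.+1 -> R) :
  tpois theta k x <= 2 * pois (tnth theta k) x ->
  \sum_z tpois theta k z * b z = 0 ->
  tpois theta k x * b ord0 ^+ 2 <=
  2 * Num.min 1 h * (h ^+ x / x`!%:R) * \sum_z tpois theta k z * b z ^+ 2.
Proof.
move=> x2 pb.
have := hide_at_point ord0 (tpois_ge0 theta0 k) (tpois_sum1 theta0 K k) pb.
set V := \sum_z _.
have V0 : 0 <= V.
  by apply: sumr_ge0 => z _; rewrite mulr_ge0 ?sqr_ge0 ?tpois_ge0.
set t := tnth theta k in x2 *.
have /andP[t0 th] : 0 <= t <= h := theta_h k.
set q := expR (- t); set p := tpois theta k ord0 => hb.
have q0 : 0 < q := expR_gt0 _.
have qp : q <= p by rewrite /q -pois0x; exact: (le_pois_tpois theta0 k ord0).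
have hb' : q * b ord0 ^+ 2 <= (1 - q) * V.
  have := sqr_ge0 (b ord0); nra.
have q1 : 1 - q <= Num.min 1 h.
  rewrite le_min; apply/andP; split; first by lra.
  by have := expR_ge1Dx (- t); rewrite -/q; lra.
set m := Num.min 1 h in q1 *.
have : tpois theta k x <= 2 * (h ^+ x / x`!%:R) * q.
  apply: le_trans x2 _; rewrite /pois -/q mulrA ler_wpM2r ?(ltW q0) //.
  rewrite ler_wpM2l // ler_wpM2r ?invr_ge0 //.
  by rewrite lerXn2r ?nnegrE // (le_trans t0).
have : 0 <= h ^+ x / x`!%:R by rewrite divr_ge0 ?exprn_ge0 // (le_trans t0).
set u := h ^+ x / _ => u0 hx.
apply: (@le_trans _ _ (2 * u * (q * b ord0 ^+ 2))).
  by rewrite mulrA ler_wpM2r ?sqr_ge0.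
rewrite (mulrAC 2 m u) -[leRHS]mulrA ler_wpM2l ?(mulr_ge0 _ u0) //.
by apply: le_trans hb' _; rewrite ler_wpM2r.
Qed.

Lemma gap_budget_cubic : 0 < h ->
  exists K0, forall K, (K0 <= K)%N ->
  gap_budget (tpois theta (K := K)) (tnth theta) (16 * h ^+ 3).
Proof.
move=> h0; have [K0 double] := tpois_le_double theta0.
exists K0 => K K0K.
(* From 4h on, the exponential tail is at most 1; for h <= 1 the surrogate at 0
   serves for every x, as a price of 1 would already cost h^2. *)
pose X := if h <= 1 then 0%N else (Num.truncn (4 * h)).+1.
pose eps (x : 'I_K.+1) : R :=
  if (x < X)%N then 1 else 2 * Num.min 1 h * (h ^+ x / x`!%:R).
have m0 : 0 <= Num.min 1 h by rewrite le_min ler01 ltW.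
have u0 x : 0 <= h ^+ x / x`!%:R by rewrite divr_ge0 ?exprn_ge0 // ltW.
exists (fun=> xpredT), (fun (x z : 'I_K.+1) => (z == if (x < X)%N then x else ord0)%:R),
  eps, (fun=> h ^+ 2); split.
- by move=> x; rewrite -[RHS](sum_point (if (x < X)%N then x else ord0) (fun=> 1));
    apply: eq_bigr => z _; rewrite mulr1.
- move=> x; rewrite sqr_ge0; split => //; rewrite /eps; case: ifP => // _.
  by rewrite mulr_ge0 ?u0 // mulr_ge0.
- move=> x j k _ _; have /andP[j0 jh] := theta_h j; have /andP[k0 kh] := theta_h k.
  by nra.
- move=> x k b _ pb; rewrite sum_point /eps; case: ifP => _.
    by rewrite mul1r; apply: hide_at_self => z; apply: tpois_ge0.
  by apply: hide_at_zero => //; apply: double.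
under eq_bigr do rewrite far_pairs_all addr0 mulrA.
rewrite -mulr_suml -mulr_sumr.
suff : \sum_x eps x <= 8 * h by have := sqr_ge0 h; nra.
rewrite (bigID (fun x : 'I_K.+1 => (x < X)%N)) /=.
under eq_bigr => x xX do rewrite /eps xX.
under [X in _ + X]eq_bigr => x xX do rewrite /eps (negbTE xX).
rewrite -mulr_sumr /X; case: ifPn => h1.
  rewrite big_pred0 // add0r.
  apply: (@le_trans _ _ (2 * h * \sum_(x < K.+1) h ^+ x / x`!%:R)).
    by rewrite (min_r h1).
  have /le_trans : \sum_(x < K.+1) h ^+ x / x`!%:R <= expR h by apply: sum_exp_terms; exact: ltW.
  have : expR h <= expR 2^-1 ^+ 2 by rewrite -expRM_natl mulfV ?ler_expR.
  have := expR_half_le2 R; have := expR_ge0 (2^-1 : R).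
  move=> a1 a2 a3 /(_ 4) a4.
  have : \sum_(x < K.+1) h ^+ x / x`!%:R <= 4 by apply: a4; nra.
  by nra.
rewrite -ltNge in h1.
have tail : \sum_(x < K.+1 | ~~ (x < (Num.truncn (4 * h)).+1)%N) h ^+ x / x`!%:R <= 1.
  rewrite (eq_bigl (fun x : 'I_K.+1 => (Num.truncn (4 * h)).+1 <= x)%N); last first.
    by move=> x; rewrite -leqNgt.
  apply: sum_exp_terms_tail; first exact: ltW.
  by rewrite ltW // truncnS_gt.
have head : \sum_(x < K.+1 | (x < (Num.truncn (4 * h)).+1)%N) (1 : R) <= 4 * h + 1.
  apply: le_trans (sum_ord_head _ _ (f := fun=> 1) _) _ => //.
  rewrite big_const card_ord iter_addr addr0.
  rewrite -(natr1 (Num.truncn (4 * h))) lerD2r truncn_le.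
  by rewrite mulr_ge0 // ltW.
rewrite min_l ?ltW // mulr1.
by lra.
Qed.

End cubic_budget.

(** * Scalar estimates for Poisson weights *)

Section scalar_bounds.
Variable R : realType.
Implicit Types (a b s th : R).

Lemma exp_term_le (c : R) x : 0 <= c -> c ^+ x / x`!%:R <= expR c.
Proof.
move=> c0; apply: le_trans (sum_exp_terms x c0).
rewrite big_ord_recr /= lerDr.
by apply: sumr_ge0 => i _; rewrite divr_ge0 ?exprn_ge0.
Qed.

(** Chernoff's bound in square-root coordinates: x^x / x! <= exp(x), and
    theta / x = (a / s)^2 <= exp(2 (a / s - 1)) for a = sqrt theta, s = sqrt x. *)
Lemma pois_le_expR th x : 0 <= th ->
  pois th x <= expR (- (Num.sqrt x%:R - Num.sqrt th) ^+ 2).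
Proof.
move=> th0; case: x => [|x].
  by rewrite pois0x sqrtr0 sub0r sqrrN sqr_sqrtr.
set s := Num.sqrt _; set a := Num.sqrt th; set X := x.+1%:R in s *.
have X0 : 0 < X by rewrite ltr0n.
have s0 : 0 < s by rewrite sqrtr_gt0.
have sX : s ^+ 2 = X by rewrite sqr_sqrtr // ltW.
have ath : a ^+ 2 = th by rewrite sqr_sqrtr.
have a0 : 0 <= a := sqrtr_ge0 _.
have -> : - (s - a) ^+ 2 = (2 * X) * (a / s - 1) + X - th.
  by rewrite -sX -ath; field; rewrite gt_eqF.
rewrite 2!expRD /pois ler_wpM2r ?expR_ge0 //.
have -> : th ^+ x.+1 / x.+1`!%:R = (a / s) ^+ (2 * x.+1) * (X ^+ x.+1 / x.+1`!%:R).
  rewrite exprM expr_div_n sX ath expr_div_n mulrA divfK //.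
  by rewrite expf_neq0 // gt_eqF.
apply: ler_pM; last exact: exp_term_le (ltW X0).
- by rewrite exprn_ge0 // divr_ge0 // ltW.
- by rewrite divr_ge0 ?exprn_ge0 // ltW.
rewrite /X -natrM expRM_natl lerXn2r ?nnegrE ?expR_ge0 ?divr_ge0 ?(ltW s0) //.
by apply: le_trans (expR_ge1Dx _); rewrite addrC subrK.
Qed.

Lemma sqr_le_le (u v : R) : 0 <= v -> u ^+ 2 <= v ^+ 2 -> u <= v.
Proof. by move=> v0 uv; rewrite leNgt; apply/negP => vu; nra. Qed.

(** The ratio of consecutive weights is theta / (y + 1); over [r] steps the product
    of the inverse ratios is at most exp(r (x + r - theta) / theta). *)
Lemma pois_shift_ge th x r i (e : R) : 0 < th -> (i <= r)%N ->
  (r%:R * (x%:R + r%:R - th) <= e * th) -> 0 <= e ->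
  pois th x <= expR e * pois th (x + i).
Proof.
move=> th0 ir re e0.
set q := (x + r)%:R / th.
have q0 : 0 <= q by rewrite divr_ge0 // ltW.
have step j : (j <= i)%N -> pois th x <= q ^+ j * pois th (x + j).
  elim: j => [|j IH] ji; first by rewrite expr0 mul1r addn0.
  apply: le_trans (IH (ltnW ji)) _; rewrite exprSr -mulrA.
  rewrite ler_wpM2l ?exprn_ge0 // addnS /q mulrAC ler_pdivlMr // mulrC -poisS.
  rewrite mulrC ler_wpM2r ?pois_ge0 ?(ltW th0) // ler_nat -addnS leq_add2l.
  exact: leq_trans ji ir.
apply: le_trans (step i (leqnn i)) _.
rewrite ler_wpM2r ?pois_ge0 ?(ltW th0) //.
have qe : q <= expR (q - 1) by apply: le_trans (expR_ge1Dx _); rewrite addrC subrK.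
apply: (@le_trans _ _ (expR (q - 1) ^+ i)).
  by rewrite lerXn2r ?nnegrE ?expR_ge0.
rewrite -expRM_natl ler_expR.
have [q1|q1] := leP (q - 1) 0; first by rewrite (le_trans _ e0) // mulr_ge0_le0.
apply: (@le_trans _ _ (r%:R * (q - 1))).
  by rewrite ler_wpM2r ?ler_nat // ltW.
rewrite -(ler_pM2r th0) -mulrA mulrBl /q divfK ?gt_eqF // mul1r.
by rewrite natrD.
Qed.

(** If [r >= 1], the bound on [r] forces sqrt x >= 10 l, whence theta >= x / 4; then
    r (x - theta) and r^2 are at most of order theta. *)
Lemma near_pois_shift (l th : R) x r i : 2^-1 <= l ^+ 2 -> 0 < l -> 0 <= th ->
  (Num.sqrt x%:R - Num.sqrt th) ^+ 2 <= 24 * l ^+ 2 ->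
  r%:R * (10 * l) <= Num.sqrt x%:R -> (i <= r)%N ->
  pois th x <= expR 5 * pois th (x + i).
Proof.
move=> l2 l0 th0; case: r => [|r] near rs ir.
  move: ir; rewrite leqn0 => /eqP ->; rewrite addn0 ler_peMl ?pois_ge0 //.
  by have := expR_ge1Dx (5 : R); lra.
set s := Num.sqrt _ in near rs; set a := Num.sqrt th in near.
have sx : s ^+ 2 = x%:R by rewrite sqr_sqrtr.
have ath : a ^+ 2 = th by rewrite sqr_sqrtr.
have a0 : 0 <= a := sqrtr_ge0 _.
have s0 : 0 <= s := sqrtr_ge0 _.
have r1 : 1 <= r.+1%:R :> R by rewrite ler1n.
set rr : R := r.+1%:R in rs r1 *.
have sl : 10 * l <= s by nra.
have sa : s - a <= 5 * l by apply: sqr_le_le; nra.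
have a_half : s / 2 <= a by lra.
have ap : 0 < a by lra.
apply: (pois_shift_ge (r := r.+1)); rewrite ?ler0n // -/rr.
  by rewrite -ath exprn_gt0.
rewrite -sx -ath.
have r2 : rr ^+ 2 * 100 * l ^+ 2 <= s ^+ 2.
  have -> : rr ^+ 2 * 100 * l ^+ 2 = (rr * (10 * l)) ^+ 2 by ring.
  by rewrite lerXn2r ?nnegrE // !mulr_ge0 // ltW.
have r3 : rr ^+ 2 * 50 <= s ^+ 2 by nra.
have s2 : s ^+ 2 <= 4 * a ^+ 2 by nra.
have [as_|sa'] := leP s a.
  have : rr * (s ^+ 2 - a ^+ 2) <= 0 
    by rewrite mulr_ge0_le0 ?subr_le0 ?lerXn2r ?nnegrE //; lra.
  by lra.
have h1 : rr * (s - a) <= s / 2.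
  apply: (@le_trans _ _ (rr * (5 * l))); first by rewrite ler_wpM2l // ltW.
  by lra.
have h2 : rr * (s ^+ 2 - a ^+ 2) <= s ^+ 2.
  have -> : rr * (s ^+ 2 - a ^+ 2) = (rr * (s - a)) * (s + a) by ring.
  apply: (@le_trans _ _ (s / 2 * (s + a))); last by nra.
  by rewrite ler_wpM2r // addr_ge0.
by lra.
Qed.

(** Averaging over [m.+1] points at which the weight is not much smaller than at
    [x] divides the price by [m.+1]. *)
Lemma hide_block (T : finType) (p b : T -> R) x m (z : 'I_m.+1 -> T) (c : R) :
  (forall y, 0 <= p y) -> injective z -> 0 <= c -> (forall i, p x <= c * p (z i)) ->
  p x * ((\sum_i b (z i)) / m.+1%:R) ^+ 2 <=
  c / m.+1%:R * \sum_y p y * b y ^+ 2.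
Proof.
move=> p0 zinj c0 pz.
have m0 : 0 < m.+1%:R :> R by rewrite ltr0n.
have := @cauchy_schwarz_sum R 'I_m.+1 (fun=> 1) (fun=> 1) (fun i => b (z i)) (fun=> ler01).
under eq_bigr do rewrite !mul1r.
under [X in _ <= X * _]eq_bigr do rewrite expr1n mul1r.
under [X in _ <= _ * X]eq_bigr do rewrite mul1r.
rewrite sumr_const card_ord => cs.
have zsum : \sum_i p (z i) * b (z i) ^+ 2 <= \sum_y p y * b y ^+ 2.
  rewrite -(big_map z xpredT (fun y => p y * b y ^+ 2)) /=.
  rewrite big_uniq /=; last by rewrite map_inj_uniq ?index_enum_uniq.
  rewrite big_mkcond; apply: ler_sum => y _; case: ifP => // _.
  by rewrite mulr_ge0 ?sqr_ge0.
apply: (@le_trans _ _ (p x * (\sum_i b (z i) ^+ 2) / m.+1%:R)).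
  rewrite -mulrA ler_wpM2l // expr_div_n ler_pdivrMr ?exprn_gt0 //.
  by rewrite [m.+1%:R ^+ 2]expr2 mulrA divfK ?gt_eqF // mulrC.
rewrite [leRHS]mulrAC ler_wpM2r ?invr_ge0 ?(ltW m0) //.
apply: le_trans (ler_wpM2l c0 zsum).
rewrite !mulr_sumr; apply: ler_sum => i _.
by rewrite [leRHS]mulrA ler_wpM2r ?sqr_ge0.
Qed.

(** Telescoping, since 1 / v <= 2 (v - u) when v^2 = u^2 + 1. *)
Lemma sum_inv_sqrt m :
  \sum_(x < m) (Num.sqrt x.+1%:R)^-1 <= 2 * Num.sqrt m%:R :> R.
Proof.
elim: m => [|m IH]; first by rewrite big_ord0 sqrtr0 mulr0.
rewrite big_ord_recr /=; apply: le_trans (lerD IH (lexx _)) _.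
set u := Num.sqrt m%:R; set v := Num.sqrt m.+1%:R.
have v0 : 0 < v by rewrite sqrtr_gt0 ltr0n.
have u0 : 0 <= u := sqrtr_ge0 _.
have v2 : v ^+ 2 = u ^+ 2 + 1 by rewrite !sqr_sqrtr // -natr1.
rewrite -(ler_pM2r v0) mulrDl mulVf ?gt_eqF //.
by have := sqr_ge0 (u - v); nra.
Qed.

Lemma sum_expR_geom m : \sum_(x < m) expR (- (x%:R / 16)) <= 17 :> R.
Proof.
set q := expR (- 16^-1 : R).
have q1 : q <= 16 / 17.
  rewrite /q expRN -[leRHS]invrK lef_pV2 ?posrE ?expR_gt0 ?invr_gt0 ?divr_gt0 //.
  by apply: le_trans (expR_ge1Dx _); lra.
have -> : \sum_(x < m) expR (- (x%:R / 16)) = \sum_(x < m) q ^+ x.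
  by apply: eq_bigr => x _; rewrite -expRM_natl mulrN.
have : (1 - q) * \sum_(x < m) q ^+ x <= 1.
  by rewrite -opprB mulNr -subrX1 opprB gerBl
    exprn_ge0 ?expR_ge0.
have : 0 <= \sum_(x < m) q ^+ x by apply: sumr_ge0 => x _; rewrite exprn_ge0 ?expR_ge0.
by nra.
Qed.

End scalar_bounds.

(** * The bound through local neighbourhoods *)

Lemma half_le_ln (R : realType) (n : nat) : (2 <= n)%N -> 2^-1 <= ln n%:R :> R.
Proof.
move=> n2; rewrite -[leLHS]expRK ler_ln ?posrE ?expR_gt0 ?ltr0n ?(ltn_trans _ n2) //.
by apply: le_trans (expR_half_le2 _) _; rewrite ler_nat.
Qed.

Lemma sqr_diff_le (R : realFieldType) (a b s m : R) : 0 <= a -> 0 <= b ->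
  (s - a) ^+ 2 <= m -> (s - b) ^+ 2 <= m ->
  (a ^+ 2 - b ^+ 2) ^+ 2 <= 4 * m * (a + b) ^+ 2.
Proof.
move=> a0 b0 am bm; rewrite subr_sqr exprMn ler_wpM2r ?sqr_ge0 //.
by have := sqr_ge0 ((s - a) + (s - b)); nra.
Qed.

(** The pairs are weighted by p_j p_k / F; summing over one index of the pair
    leaves the weights of the other. *)
Lemma far_pairs_le (R : realFieldType) (I T : finType) (p : I -> T -> R) th x
    (G : pred I) (b c : R) (u : I -> R) :
  (forall i y, 0 <= p i y) -> 0 <= b -> 0 <= c -> (forall i, 0 <= u i) ->
  (forall j k, 0 < total_mass p x -> ~~ (G j && G k) ->
    p j x * p k x * (th j - th k) ^+ 2 / total_mass p x <=
    b + c * (p j x * p k x / total_mass p x) * (u j + u k)) ->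
  far_pairs p th x G <= #|I|%:R ^+ 2 * b + 2 * c * \sum_j p j x * u j.
Proof.
move=> p0 b0 c0 u0; rewrite /far_pairs; set F := total_mass p x => bound.
have S0 : 0 <= \sum_j p j x * u j by apply: sumr_ge0 => j _; rewrite mulr_ge0.
have [F0|Fn0] := eqVneq F 0.
  by rewrite F0 invr0 mulr0 addr_ge0 // mulr_ge0 ?sqr_ge0 ?mulr_ge0.
have Fp : 0 < F by rewrite lt_neqAle eq_sym Fn0 total_mass_ge0.
have BE : \sum_(j : I) \sum_(k : I) b = #|I|%:R ^+ 2 * b.
  by rewrite !sumr_const -mulrnA -[LHS]mulr_natl natrM.
have half : \sum_j \sum_k (p j x * p k x / F) * u j = \sum_j p j x * u j.
  apply: eq_bigr => j _; transitivity ((p j x * u j / F) * F).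
    rewrite {2}/F /total_mass mulr_sumr; apply: eq_bigr => k _; ring.
  by rewrite divfK.
have half' : \sum_j \sum_k (p j x * p k x / F) * u k = \sum_j p j x * u j.
  rewrite exchange_big -half /=; apply: eq_bigr => j _.
  by apply: eq_bigr => k _; rewrite (mulrC (p j x)).
have CE : \sum_j \sum_k c * (p j x * p k x / F) * (u j + u k) =
    2 * c * \sum_j p j x * u j.
  transitivity (c * (\sum_j p j x * u j + \sum_j p j x * u j)); last by ring.
  rewrite -{1}half -half' -big_split mulr_sumr; apply: eq_bigr => j _ /=.
  by rewrite -big_split mulr_sumr; apply: eq_bigr => k _ /=; ring.
rewrite -BE -CE -big_split mulr_suml; apply: ler_sum => j _ /=.
rewrite -big_split mulr_suml big_mkcond /=; apply: ler_sum => k _.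
case: ifPn => [bad|_]; first exact: bound.
apply: addr_ge0 => //; apply: mulr_ge0; last by rewrite addr_ge0.
by rewrite mulr_ge0 // mulr_ge0 ?invr_ge0 ?(ltW Fp) // mulr_ge0.
Qed.

Section local_budget.
Variables (R : realType) (n : nat) (theta : n.-tuple R) (H h0 A : R).
Hypothesis n2 : (2 <= n)%N.
Hypothesis theta0 : nonneg_params theta.
Hypothesis theta_H : forall i, tnth theta i <= H.
Let N : R := n%:R.
Let L : R := ln N.
Let l : R := Num.sqrt L.
Let th i := tnth theta i.
Hypothesis L_h0 : L <= h0.
Hypothesis A1 : 1 <= A.
Hypothesis H_A : H <= A * N ^+ 2.

Let s (x : nat) : R := Num.sqrt x%:R.
Let a i := Num.sqrt (th i).
(** Square-root coordinates make the Poisson fluctuations of order 1, whatever the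
    parameter; 24 is large enough for the atypical observations to contribute at
    most a constant, see [tail_exp]. *)
Let near x i := ((s x - a i) ^+ 2 <= 24 * L) && (th i <= h0).
Let rad x := Num.truncn (s x / (10 * l)).
Let X1 := (Num.truncn (36 * h0)).+1.
Let T i := if h0 < th i then th i else 0.

Let L2 : 2^-1 <= L. Proof. exact: half_le_ln. Qed.
Let L0 : 0 < L. Proof. by apply: lt_le_trans L2; rewrite invr_gt0. Qed.
Let l0 : 0 < l. Proof. by rewrite sqrtr_gt0. Qed.
Let ll : l ^+ 2 = L. Proof. by rewrite sqr_sqrtr // ltW. Qed.
Let h00 : 0 < h0. Proof. exact: lt_le_trans L0 L_h0. Qed.
Let N0 : 0 < N. Proof. by rewrite ltr0n (ltn_trans _ n2). Qed.
Let aa i : a i ^+ 2 = th i. Proof. by rewrite sqr_sqrtr. Qed.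
Let a0 i : 0 <= a i. Proof. exact: sqrtr_ge0. Qed.
Let ss x : s x ^+ 2 = x%:R. Proof. by rewrite sqr_sqrtr. Qed.
Let s0 x : 0 <= s x. Proof. exact: sqrtr_ge0. Qed.
Let T0 i : 0 <= T i.
Proof. by rewrite /T; case: ifP => // _; exact: theta0. Qed.

Let near_lt x i : near x i -> (x < X1)%N.
Proof.
move=> /andP[sa ai].
rewrite -(@ltr_nat R); apply: le_lt_trans (truncnS_gt _); rewrite -(ss x).
(* 36 is (1 + 5)^2, where 5 exceeds the square root of 24. *)
pose c := Num.sqrt h0.
have cc : c ^+ 2 = h0 by rewrite sqr_sqrtr // ltW.
have c0 : 0 <= c := sqrtr_ge0 _.
have ac : a i <= c by apply: sqr_le_le => //; rewrite aa cc.
have sac : s x - a i <= 5 * c.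
  apply: sqr_le_le; first by rewrite mulr_ge0.
  by rewrite exprMn cc; have := L_h0; have := h00; lra.
rewrite -cc (_ : 36 * c ^+ 2 = (6 * c) ^+ 2); last by ring.
by rewrite lerXn2r ?nnegrE ?mulr_ge0 //; lra.
Qed.

Let near_close x j k : near x j -> near x k ->
  (th j - th k) ^+ 2 <= 16 * 24 * L * h0.
Proof.
move=> /andP[sj jh] /andP[sk kh]; rewrite -!aa.
apply: le_trans (sqr_diff_le (a0 j) (a0 k) sj sk) _.
have -> : 16 * 24 * L * h0 = 4 * (24 * L) * (4 * h0) by ring.
rewrite ler_wpM2l ?mulr_ge0 ?(ltW L0) //.
by rewrite -aa in jh; rewrite -aa in kh; have := sqr_ge0 (a j - a k); nra.
Qed.

Let rad_le x : (rad x)%:R * (10 * l) <= s x.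
Proof.
by rewrite -ler_pdivlMr ?mulr_gt0 ?l0 // truncn_le divr_ge0 ?s0 // mulr_ge0 // ltW ?l0.
Qed.

Let inv_rad_le x : (rad x).+1%:R^-1 <= 20 * l / s x.+1.
Proof.
have sx1 : 0 < s x.+1 by rewrite sqrtr_gt0 ltr0n.
have r0 : 0 < (rad x).+1%:R :> R by rewrite ltr0n.
rewrite ler_pdivlMr // ler_pdivrMl //.
have : s x < (rad x).+1%:R * (10 * l).
  by rewrite -ltr_pdivrMr ?mulr_gt0 // truncnS_gt.
have : 10 * l <= (rad x).+1%:R * (10 * l).
  by rewrite ler_peMl ?ler1n // mulr_ge0 // ltW.
have : 1 <= 10 * l by apply: sqr_le_le; rewrite ?mulr_ge0 ?(ltW l0) // exprMn ll; have := L2; lra.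
have : s x.+1 <= s x + 1.
  apply: sqr_le_le; first by rewrite addr_ge0.
  by rewrite ss -natr1 -ss; have := s0 x; nra.
by lra.
Qed.

Let tail_exp (m : R) : 24 * L < m -> expR (- (m / 4)) <= (N ^+ 6)^-1.
Proof.
move=> hm; have -> : (N ^+ 6)^-1 = expR (- (6%:R * L)).
  by rewrite expRN expRM_natl lnK ?posrE.
by rewrite ler_expR; lra.
Qed.

(** Summable majorant in [x] of the Gaussian factor left after [tail_exp]. *)
Let psi (x : nat) : R := ((x%:R <= 4 * H)%R)%:R + expR (- (x%:R / 16)).

Let psi_ge x j (m : R) : (s x - a j) ^+ 2 <= m -> expR (- (m / 4)) <= psi x.
Proof.
move=> hm; rewrite /psi; case: (leP x%:R (4 * H)) => [_|xH].
  rewrite -[leLHS]addr0 lerD ?expR_ge0 //.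
  by rewrite -[true%:R]expR0 ler_expR; have := sqr_ge0 (s x - a j); lra.
rewrite add0r ler_expR.
have as2 : a j <= s x / 2.
  apply: sqr_le_le; first by rewrite divr_ge0.
  by rewrite aa expr_div_n ss; have := theta_H j; rewrite -/(th j); lra.
suff : x%:R / 4 <= m by lra.
apply: le_trans hm; rewrite -ss.
by have := s0 x; nra.
Qed.

(** One of the two parameters is atypical for [x]: half of the exponent pays for
    the size of (theta_j - theta_k)^2, a quarter for the power of [N] that beats
    the number of pairs, a quarter for the summation over [x]. *)
Let far_term_tail x j k (P Q F : R) : 0 <= P -> 0 <= Q -> Q <= F -> 0 < F ->
  P <= 2 * pois (th j) x ->
  24 * L < (s x - a j) ^+ 2 -> (s x - a k) ^+ 2 <= (s x - a j) ^+ 2 ->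
  P * Q * (th j - th k) ^+ 2 / F <= 64 * H * (N ^+ 6)^-1 * psi x.
Proof.
move=> P0 Q0 QF F0 Pp; set m := (s x - a j) ^+ 2 => mL km.
have H0 : 0 <= H := le_trans (theta0 j) (theta_H j).
have m0 : 0 <= m := sqr_ge0 _.
have d2 : (th j - th k) ^+ 2 <= 16 * m * H.
  rewrite -!aa; apply: le_trans (sqr_diff_le (a0 j) (a0 k) (lexx m) km) _.
  rewrite (_ : 16 * m * H = 4 * m * (4 * H)); last by ring.
  rewrite ler_wpM2l ?(mulr_ge0 _ m0) //.
  have := theta_H j; have := theta_H k; rewrite -/(th j) -/(th k) -!aa => hk hj.
  by have := sqr_ge0 (a j - a k); nra.
have PQ : P * Q / F <= P.
  by rewrite -mulrA ler_piMr // ler_pdivrMr // mul1r.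
have Pm : P <= 2 * expR (- m).
  by apply: le_trans Pp _; rewrite ler_wpM2l // pois_le_expR.
rewrite mulrAC.
apply: (@le_trans _ _ (2 * expR (- m) * (16 * m * H))).
  apply: ler_pM; rewrite ?sqr_ge0 ?divr_ge0 ?mulr_ge0 ?(ltW F0) //.
  exact: le_trans PQ Pm.
have me : m <= 2 * expR (m / 2) by have := expR_ge1Dx (m / 2); lra.
have e1 : expR (- m) = expR (- (m / 4)) * expR (- (m / 4)) * (expR (m / 2))^-1.
  by rewrite -expRN -!expRD; congr expR; field.
have em0 := expR_gt0 (m / 2).
apply: (@le_trans _ _ (64 * H * (expR (- (m / 4)) * expR (- (m / 4))))).
  rewrite e1.
  have -> : 2 * (expR (- (m / 4)) * expR (- (m / 4)) / expR (m / 2)) * (16 * m * H)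
    = 32 * H * (expR (- (m / 4)) * expR (- (m / 4))) * (m / expR (m / 2)).
    by ring.
  have -> : 64 * H * (expR (- (m / 4)) * expR (- (m / 4))) =
     32 * H * (expR (- (m / 4)) * expR (- (m / 4))) * 2 by ring.
  rewrite ler_wpM2l ?mulr_ge0 ?expR_ge0 //.
  by rewrite ler_pdivrMr.
rewrite -[leRHS]mulrA ler_wpM2l ?mulr_ge0 //.
by apply: ler_pM; rewrite ?expR_ge0 ?tail_exp // (psi_ge (lexx _)).
Qed.

(** Both parameters are typical for [x] but one is above the threshold; their
    difference is then controlled by the larger one. *)
Let far_term_large x j k (P Q F : R) : 0 <= P -> 0 <= Q -> 0 < F ->
  (s x - a j) ^+ 2 <= 24 * L -> (s x - a k) ^+ 2 <= 24 * L ->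
  h0 < th j -> th k <= th j ->
  P * Q * (th j - th k) ^+ 2 / F <= 16 * 24 * L * (P * Q / F) * (T j + T k).
Proof.
move=> P0 Q0 F0 sj sk hj kj.
have -> : 16 * 24 * L * (P * Q / F) * (T j + T k) =
  P * Q / F * (16 * 24 * L * (T j + T k)) by ring.
rewrite mulrAC ler_wpM2l //.
  by rewrite divr_ge0 ?mulr_ge0 // ltW.
apply: (@le_trans _ _ (16 * 24 * L * th j)); last first.
  have -> : th j = T j by rewrite /T hj.
  have := T0 k; have := L0; nra.
rewrite -!aa; apply: le_trans (sqr_diff_le (a0 j) (a0 k) sj sk) _.
have -> : 16 * 24 * L * a j ^+ 2 = 4 * (24 * L) * (4 * a j ^+ 2) by ring.
rewrite ler_wpM2l ?mulr_ge0 ?(ltW L0) //.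
rewrite -!aa in kj; have := sqr_ge0 (a j - a k); nra.
Qed.

Let H_ge0 : 0 <= H.
Proof. exact: le_trans (theta0 (Ordinal n2)) (theta_H _). Qed.

Let psi0 x : 0 <= psi x.
Proof. by rewrite addr_ge0 ?expR_ge0. Qed.

Let N_ge1 : 1 <= N.
Proof. by rewrite ler1n (ltn_trans _ n2). Qed.

Section at_level.
Variable K : nat.
Hypothesis double : forall i (x : 'I_K.+1),
  tpois theta i x <= 2 * pois (th i) x.
Let tp := @tpois R n theta K.
Let tp0 i x : 0 <= tp i x. Proof. exact: tpois_ge0. Qed.

Let far_term (x : 'I_K.+1) j k : 0 < total_mass tp x ->
  ~~ (near x j && near x k) ->
  tp j x * tp k x * (th j - th k) ^+ 2 / total_mass tp x <=
  64 * H * (N ^+ 6)^-1 * psi x +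
  16 * 24 * L * (tp j x * tp k x / total_mass tp x) * (T j + T k).
Proof.
set F := total_mass tp x => F0 bad.
have B0 : 0 <= 64 * H * (N ^+ 6)^-1 * psi x.
  by rewrite mulr_ge0 ?psi0 // mulr_ge0 ?invr_ge0 ?exprn_ge0 ?(ltW N0) // mulr_ge0 ?H_ge0.
have C0 : 0 <= 16 * 24 * L * (tp j x * tp k x / F) * (T j + T k).
  apply: mulr_ge0; last by rewrite addr_ge0 ?T0.
  apply: mulr_ge0; first by rewrite mulr_ge0 // (ltW L0).
  by rewrite mulr_ge0 ?invr_ge0 ?(ltW F0) // mulr_ge0 ?tp0.
have symE : tp j x * tp k x * (th j - th k) ^+ 2 = tp k x * tp j x * (th k - th j) ^+ 2.
  by ring.
have tpF i : tp i x <= F by apply: le_total_mass.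
have [kj|jk] := leP ((s x - a k) ^+ 2) ((s x - a j) ^+ 2).
  have [sj|sj] := ltP (24 * L) ((s x - a j) ^+ 2).
    by rewrite -[leLHS]addr0 lerD // (far_term_tail (tp0 j x) (tp0 k x)).
  have sk := le_trans kj sj.
  rewrite -[leLHS]add0r lerD //.
  move: bad; rewrite /near sj sk /= negb_and -!ltNge => bad.
  have [kj'|jk'] := leP (th k) (th j).
    apply: (far_term_large (tp0 j x) (tp0 k x) F0 sj sk _ kj').
    by case/orP: bad => // /lt_le_trans; apply.
  rewrite symE (mulrC (tp j x)) (addrC (T j)).
  apply: (far_term_large (tp0 k x) (tp0 j x) F0 sk sj _ (ltW jk')).
  by case/orP: bad => // /lt_trans; apply.
have [sk|sk] := ltP (24 * L) ((s x - a k) ^+ 2).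
  by rewrite -[leLHS]addr0 lerD // symE (far_term_tail (tp0 k x) (tp0 j x)) // ltW.
have sj := le_trans (ltW jk) sk.
rewrite -[leLHS]add0r lerD //.
move: bad; rewrite /near sj sk /= negb_and -!ltNge => bad.
have [kj'|jk'] := leP (th k) (th j).
  apply: (far_term_large (tp0 j x) (tp0 k x) F0 sj sk _ kj').
    by case/orP: bad => // /lt_le_trans; apply.
rewrite symE (mulrC (tp j x)) (addrC (T j)).
apply: (far_term_large (tp0 k x) (tp0 j x) F0 sk sj _ (ltW jk')).
  by case/orP: bad => // /lt_trans; apply.
Qed.

Let far_at (x : 'I_K.+1) : far_pairs tp th x (near x) <=
  64 * H * (N ^+ 4)^-1 * psi x + 2 * (16 * 24 * L) * \sum_j tp j x * T j.
Proof.
have B0 : 0 <= 64 * H * (N ^+ 6)^-1 * psi x.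
  apply: mulr_ge0; last exact: psi0.
  by rewrite mulr_ge0 ?invr_ge0 ?exprn_ge0 ?(ltW N0) // mulr_ge0 ?H_ge0.
have C0 : 0 <= 16 * 24 * L by rewrite mulr_ge0 // (ltW L0).
apply: le_trans (far_pairs_le tp0 B0 C0 T0 (@far_term x)) _.
rewrite card_ord -/N lerD2r le_eqVlt; apply/orP; left; apply/eqP.
by field; rewrite gt_eqF // N0.
Qed.

Let sum_psi : \sum_(x < K.+1) psi x <= 4 * H + 18.
Proof.
rewrite big_split /=.
have -> : 4 * H + 18 = (4 * H + 1) + 17 by ring.
apply: lerD; last exact: sum_expR_geom.
apply: (@le_trans _ _ (\sum_(x < K.+1 | (x < (Num.truncn (4 * H)).+1)%N) 1)).
  rewrite [leRHS]big_mkcond /=; apply: ler_sum => x _.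
  case: (leP x%:R (4 * H)) => [xH|_]; last by case: ifP.
  by rewrite -(@ltr_nat R) (le_lt_trans xH) ?truncnS_gt.
apply: le_trans (sum_ord_head _ _ (f := fun=> 1) _) _ => //.
rewrite big_const card_ord iter_addr addr0.
rewrite -(natr1 (Num.truncn (4 * H))) lerD2r truncn_le.
by rewrite mulr_ge0 ?H_ge0.
Qed.

Let far_total : \sum_(x < K.+1) far_pairs tp th x (near x) <=
  64 * (22 * A ^+ 2) + 2 * (16 * 24 * L) * \sum_j T j.
Proof.
apply: (le_trans (ler_sum _ (fun x _ => far_at x))).
rewrite big_split /= -!mulr_sumr; apply: lerD.
  have hA : H * (4 * H + 18) <= 22 * A ^+ 2 * N ^+ 4.
    have NN : 1 <= N ^+ 2 by rewrite exprn_ege1 ?N_ge1.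
    have AN : 1 <= A * N ^+ 2 by have := A1; nra.
    have -> : 22 * A ^+ 2 * N ^+ 4 = (A * N ^+ 2) * (22 * (A * N ^+ 2)) by ring.
    by apply: ler_pM; have := H_ge0; have := H_A; lra.
  apply: (@le_trans _ _ (64 * H * (N ^+ 4)^-1 * (4 * H + 18))).
    rewrite ler_wpM2l ?sum_psi //.
    by rewrite mulr_ge0 ?invr_ge0 ?exprn_ge0 ?(ltW N0) // mulr_ge0 ?H_ge0.
  have -> : 64 * H * (N ^+ 4)^-1 * (4 * H + 18) = 64 * (H * (4 * H + 18) / N ^+ 4).
    by ring.
  by rewrite ler_wpM2l // ler_pdivrMr // exprn_gt0 // N0.
rewrite exchange_big /= ler_wpM2l //.
  by rewrite mulr_ge0 // mulr_ge0 // (ltW L0).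
by apply: ler_sum => j _; rewrite -mulr_suml tpois_sum1 // mul1r.
Qed.

Hypothesis K_large : forall x, (x < X1)%N -> (x + rad x <= K)%N.

(** Uniform weights on [x, x + rad x]. *)
Let kappa (x z : 'I_K.+1) : R :=
  (\sum_(i < (rad x).+1) (z == inord (x + i))%:R) / (rad x).+1%:R.

Let kappaE (x : 'I_K.+1) (b : 'I_K.+1 -> R) :
  \sum_z kappa x z * b z = (\sum_(i < (rad x).+1) b (inord (x + i))) / (rad x).+1%:R.
Proof.
under [in RHS]eq_bigr do rewrite -sum_point.
rewrite exchange_big /= mulr_suml; apply: eq_bigr => z _.
by rewrite -mulr_suml mulrAC.
Qed.

Lemma gap_budget_local_at : gap_budget tp th
  (2 * (16 * 24 * 20 * 14) * expR 5 * (L * h0 * Num.sqrt (L * h0)) + 4 * (16 * 24 * L) * \sum_j T j +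
   2 * (64 * (22 * A ^+ 2))).
Proof.
pose eps (x : 'I_K.+1) : R := expR 5 / (rad x).+1%:R.
pose M (x : 'I_K.+1) : R := if (x < X1)%N then 16 * 24 * L * h0 else 0.
have M1 : 0 <= 16 * 24 * L * h0 by rewrite mulr_ge0 ?(ltW h00) // mulr_ge0 // ltW ?L0.
exists (fun (x : 'I_K.+1) => near x), kappa, eps, M; split.
- move=> x; transitivity (\sum_z kappa x z * 1); first by apply: eq_bigr => z _; rewrite mulr1.
  rewrite kappaE sumr_const card_ord divff //.
- move=> x; split; first by rewrite divr_ge0 ?expR_ge0.
  by rewrite /M; case: ifP.
- by move=> x j k nj nk; rewrite /M (near_lt nj); exact: near_close nj nk.
- move=> x k b nk pb; rewrite kappaE.
  have xX := K_large (near_lt nk).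
  apply: hide_block => [y|i i' |//|i]; rewrite ?expR_ge0 //.
    have iK (c : 'I_(rad x).+1) : (x + c < K.+1)%N.
      by rewrite ltnS (leq_trans _ xX) // leq_add2l -ltnS.
    move/(congr1 (@nat_of_ord _)); rewrite !inordK // => /addnI.
    exact: val_inj.
  rewrite /tp /tpois mulrA ler_wpM2r ?invr_ge0 ?(ltW (pois_head_gt0 _ _)) //.
  rewrite inordK; last by rewrite ltnS (leq_trans _ xX) // leq_add2l -ltnS.
  case/andP: nk => nk _.
  apply: (near_pois_shift (l := l) (r := rad x)); rewrite ?ll ?L2 ?l0 ?rad_le //.
  by rewrite -ltnS.
rewrite -mulr_sumr big_split /= mulrDr.
have := far_total.
suff : \sum_x eps x * M x <= 16 * 24 * 20 * 14 * expR 5 * (L * h0 * Num.sqrt (L * h0)).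
  by rewrite -/th; lra.
pose f x : R := expR 5 * (20 * l / s x.+1) * (16 * 24 * L * h0).
apply: (@le_trans _ _ (\sum_(x < K.+1 | (x < X1)%N) f x)).
  rewrite [leRHS]big_mkcond; apply: ler_sum => x _ /=; rewrite /M.
  case: ifP => _; last by rewrite mulr0.
  by rewrite ler_wpM2r // /eps ler_wpM2l ?expR_ge0 ?inv_rad_le.
apply: le_trans (sum_ord_head _ _ _) _ => [x|].
  by rewrite mulr_ge0 // mulr_ge0 ?expR_ge0 // divr_ge0 ?s0 // mulr_ge0 // ltW ?l0.
rewrite -mulr_suml -mulr_sumr.
under eq_bigr do rewrite -mulrA.
rewrite -mulr_sumr -mulr_sumr.
have h := sum_inv_sqrt R X1.
have X1_le : Num.sqrt X1%:R <= 7 * Num.sqrt h0 :> R.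
  apply: sqr_le_le; first by rewrite mulr_ge0.
  rewrite sqr_sqrtr // exprMn sqr_sqrtr ?(ltW h00) // /X1 -natr1.
  have : (Num.truncn (36 * h0))%:R <= 36 * h0 by rewrite truncn_le mulr_ge0 // ltW ?h00.
  by have := L_h0; have := L2; lra.
have hs : \sum_(x < X1) (s x.+1)^-1 <= 14 * Num.sqrt h0.
  by apply: le_trans h _; have := X1_le; lra.
apply: (@le_trans _ _ (expR 5 * (20 * (l * (14 * Num.sqrt h0))) * (16 * 24 * L * h0))).
  rewrite ler_wpM2r // ler_wpM2l ?expR_ge0 // ler_wpM2l // ler_wpM2l // ltW ?l0 //.
rewrite sqrtrM ?(ltW L0) // -/l.
by rewrite le_eqVlt; apply/orP; left; apply/eqP; ring.
Qed.

End at_level.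

(** The first term comes from the near pairs, the second one from the parameters
    above the threshold [h0], the last one from the atypical observations. *)
Lemma gap_budget_local : exists K0, forall K, (K0 <= K)%N ->
  gap_budget (tpois theta (K := K)) (tnth theta)
  (2 * (16 * 24 * 20 * 14) * expR 5 * (ln n%:R * h0 * Num.sqrt (ln n%:R * h0)) + 4 * (16 * 24 * ln n%:R) *
     \sum_j (if h0 < tnth theta j then tnth theta j else 0) +
   2 * (64 * (22 * A ^+ 2))).
Proof.
have [K0 double] := tpois_le_double theta0.
exists (maxn K0 (X1 + \max_(x < X1) rad x)) => K.
rewrite geq_max => /andP[K0K XK]; apply: gap_budget_local_at.
  exact: double.
move=> x xX; apply: leq_trans XK; apply: leq_add; first exact: ltnW.
exact: (leq_bigmax_cond (F := fun x : 'I_X1 => rad x) (Ordinal xX)).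
Qed.

End local_budget.

(** * Boxes of parameters *)

Section box_gaps.
Variables (R : realType) (n : nat).
Implicit Types (theta : n.-tuple R) (d : estimator R n).

(** Partial sums of the variance telescope, as those of a discrete derivative. *)
Lemma pois_variance_head (t : R) m :
  \sum_(x < m) pois t x * ((x%:R - t) ^+ 2 - t) =
  - (m%:R * pois t m * (m%:R - t)).
Proof.
elim: m => [|m IH]; first by rewrite big_ord0 !mul0r oppr0.
rewrite big_ord_recr /= IH (mulrC m.+1%:R) poisS -(natr1 m); ring.
Qed.

(** The separable oracle is at least as good as the rule that returns the
    observations, whose risk is the sum of the variances. *)
Lemma mse_sep_rule_le_sum theta : nonneg_params theta ->
  (mse theta (coordinatewise (sep_rule theta)) <= (\sum_i tnth theta i)%:E)%E.
Proof.
move=> theta0; apply: mse_coordinatewise_le => // K.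
pose K' := (K + (Num.truncn (\sum_i tnth theta i)).+1)%N.
have KK' : (K <= K')%N by exact: leq_addr.
apply: le_trans (box_risk_homo theta0 _ KK') _.
apply: le_trans (sep_rule_min theta0 (fun x => x%:R) K') _.
rewrite /box_risk exchange_big /=; apply: ler_sum => i _.
set t := tnth theta i.
have tK : t <= K'.+1%:R.
  apply: (@le_trans _ _ (\sum_i tnth theta i)).
    by rewrite (bigD1 i) //= lerDl sumr_ge0.
  apply: (le_trans (ltW (truncnS_gt _))).
  by rewrite ler_nat; apply: leqW; exact: leq_addl.
have := pois_variance_head t K'.+1.
under [X in X = _ -> _]eq_bigr do rewrite mulrBr.
rewrite sumrB -mulr_suml => /(canRL (subrK _)) ->.
have m1 := pois_head_le1 K' (theta0 i); rewrite -/t /pois_head in m1.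
apply: (@le_trans _ _ (0 + 1 * t)); last by rewrite add0r mul1r.
rewrite lerD ?ler_wpM2r ?theta0 // oppr_le0 mulr_ge0 ?subr_ge0 //.
by rewrite mulr_ge0 ?pois_ge0 ?theta0.
Qed.

Lemma box_gap_cubic (h : R) theta d : 0 < h -> box_params h theta ->
  perm_invariant d ->
  (mse theta (coordinatewise (sep_rule theta)) <= mse theta d + (16 * h ^+ 3)%:E)%E.
Proof.
move=> h0 theta_h dPI.
have theta0 : nonneg_params theta by move=> i; have /andP[] := theta_h i.
exact: mse_sep_rule_le_PI theta0 dPI (gap_budget_cubic theta_h h0).
Qed.

Lemma box_params_nonneg (h : R) : @box_params R n h `<=` @nonneg_params R n.
Proof. by move=> theta theta_h i; have /andP[] := theta_h i. Qed.

Lemma mse_ge0 theta d : nonneg_params theta -> (0 <= mse theta d)%E.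
Proof. by move=> theta0; apply: esum_ge0 => x _; rewrite lee_fin loss_ge0. Qed.

Definition local_const : R := 2 * (16 * 24 * 20 * 14) * expR 5.

Lemma local_const_ge0 : 0 <= local_const.
Proof. by rewrite mulr_ge0 ?expR_ge0. Qed.

(** For [h < ln n] the cubic bound is the smaller one.  For [h >= n ^ 2] the trivial
    bound [n * h] suffices.  In between the parameters are polynomial in [n], as
    [gap_budget_local] requires. *)
Lemma box_gap_local (h : R) theta d : (2 <= n)%N -> 0 < h ->
  box_params h theta ->
  perm_invariant d ->
  (mse theta (coordinatewise (sep_rule theta)) <= mse theta d +
    ((local_const + 16 * (64 * 22)) * (h * ln n%:R * Num.sqrt (h * ln n%:R)))%:E)%E.
Proof.
move=> n2 h0 theta_h dPI.
have theta0 : nonneg_params theta := box_params_nonneg theta_h.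
have L2 := half_le_ln R n2; set L := ln _ in L2 *.
have N0 : 0 < n%:R :> R by rewrite ltr0n (ltn_trans _ n2).
have c0 := local_const_ge0.
have c16 : 16 <= local_const + 16 * (64 * 22) :> R.
  by rewrite -[leLHS]add0r lerD // ler_peMr // -natrM ler1n.
have L0 : 0 < L by lra.
set q := Num.sqrt (h * L).
have q0 : 0 <= q := sqrtr_ge0 _.
have qq : q ^+ 2 = h * L by rewrite sqr_sqrtr // mulr_ge0 // ltW.
have raise (r : R) : r <= (local_const + 16 * (64 * 22)) * (h * L * q) ->
    (mse theta (coordinatewise (sep_rule theta)) <= mse theta d + r%:E)%E ->
    (mse theta (coordinatewise (sep_rule theta)) <=
     mse theta d + ((local_const + 16 * (64 * 22)) * (h * L * q))%:E)%E.
  by move=> rC; move/le_trans; apply; rewrite leeD2l // lee_fin.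
have [hL|Lh] := ltP h L.
  apply: raise (box_gap_cubic h0 theta_h dPI).
  have hq : h <= q by apply: sqr_le_le => //; rewrite qq expr2 ler_wpM2l // ltW.
  have : h ^+ 3 <= h * L * q.
    rewrite exprSr expr2; apply: ler_pM; rewrite ?mulr_ge0 ?(ltW h0) //.
    by rewrite ler_wpM2l // ltW.
  have : 0 <= h * L * q by rewrite !mulr_ge0 // ltW.
  move=> hLq0 /(ler_wpM2l (ler0n R 16)) /le_trans; apply.
  by rewrite ler_wpM2r.
have [hn|nh] := leP (n%:R ^+ 2) h.
  apply: (raise (4 * (h * L * q))).
    have hLq0 : 0 <= h * L * q by rewrite !mulr_ge0 // ltW.
    by rewrite ler_wpM2r // (le_trans _ c16) // ler_nat.
  apply: (le_trans (mse_sep_rule_le_sum theta0)).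
  rewrite -[leLHS]add0e leeD ?mse_ge0 // lee_fin.
  apply: (@le_trans _ _ (n%:R * h)).
    rewrite mulr_natl -[in leRHS](card_ord n) -sumr_const.
    by apply: ler_sum => i _; have /andP[] := theta_h i.
  have nq : n%:R <= 2 * q by apply: sqr_le_le; rewrite ?mulr_ge0 // exprMn qq; nra.
  apply: (@le_trans _ _ (2 * q * h)); first by rewrite ler_wpM2r // ltW.
  have -> : 4 * (h * L * q) = 2 * q * h * (2 * L) by ring.
  by rewrite ler_peMr ?mulr_ge0 // ?(ltW h0) //; lra.
apply: raise (mse_sep_rule_le_PI theta0 dPI
  (gap_budget_local n2 theta0 (H := h) (h0 := h) (A := 1) _ _ _ _)) => //.
- rewrite big1 => [|i _]; last first.
    by have /andP[_] := theta_h i; rewrite leNgt => /negbTE ->.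
  rewrite mulr0 addr0 expr1n mulr1 -/local_const -/L (mulrC L) -/q.
  rewrite [leRHS]mulrDl lerD2l.
  have hL4 : 2^-1 ^+ 2 <= h * L by nra.
  have q2 : 2^-1 <= q by apply: sqr_le_le; rewrite ?qq.
  have q3 : 2^-1 ^+ 3 <= h * L * q by rewrite exprSr; apply: ler_pM => //; lra.
  rewrite [leLHS]mulrC -mulrA [leRHS]mulrCA ler_wpM2l ?mulr_ge0 //.
  by rewrite mulrC -ler_pdivrMr //; lra.
- by move=> i; have /andP[] := theta_h i.
- by rewrite mul1r ltW.
Qed.

End box_gaps.

(** * Empirical distributions *)

Section empirical_measure.
Variables (R : realType) (n : nat).
Implicit Types (theta : n.-tuple R).

Lemma empirical_ge theta (A : set R) i : (0 < n)%N -> A (tnth theta i) ->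
  (((n%:R^-1 : R)%:E <= empirical theta (A : set (measurableTypeR R)))%E).
Proof.
move=> n0 Ai; rewrite /empirical /= /mscale /= /msum /=.
rewrite -[leLHS]mule1 lee_pmul2l ?lte_fin ?invr_gt0 ?ltr0n //.
rewrite (bigD1 i) //= -tnth_nth diracE mem_set // leeDl //.
by apply: sume_ge0 => k _.
Qed.

(** The largest parameter has empirical mass at least 1 / n, and
    ln (2 n) <= 2 ln n. *)
Lemma subexp_params_le (s : R) theta i : (2 <= n)%N -> 0 < s ->
  subexp_params s theta -> tnth theta i <= 2 * s * ln n%:R.
Proof.
move=> n2 s0 [theta0 sub]; set t := tnth theta i.
have N0 : 0 < n%:R :> R by rewrite ltr0n (ltn_trans _ n2).
have L0 : 0 < ln n%:R :> R by have := half_le_ln R n2; lra.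
have [t0|t0] := leP t 0.
  by apply: (le_trans t0); rewrite !mulr_ge0 // ltW.
have := sub t t0.
have mem : `[t, +oo[%classic t by rewrite /= in_itv /= lexx.
move/(le_trans (empirical_ge (ltnW n2) mem)).
rewrite lee_fin mulNr expRN => h.
have : expR (t / s) <= 2 * n%:R.
  by move: h; rewrite ler_pdivlMr ?expR_gt0 // ler_pdivrMl // (mulrC 2).
move=> h2; have {}h2 : expR (t / s) <= n%:R ^+ 2.
  by apply: le_trans h2 _; rewrite expr2 ler_wpM2r ?(ltW N0) // ler_nat.
have : t / s <= 2%:R * ln n%:R.
  rewrite -ler_expR expRM_natl lnK ?posrE //.
by rewrite ler_pdivrMr // => /le_trans; apply; rewrite mulrAC.
Qed.

Lemma moment_params_sum (p C0 : R) theta : (0 < n)%N ->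
  moment_params p C0 theta ->
  \sum_i tnth theta i `^ p <= n%:R * C0.
Proof.
move=> n0 [theta0 /=].
have mf : measurable_fun [set: measurableTypeR R]
    ((fun u => ((u : R) `^ p)%:E) : measurableTypeR R -> \bar R).
  apply/measurable_EFinP; exact: measurable_powR.
have f0 (u : measurableTypeR R) : [set: measurableTypeR R] u -> (0 <= ((u : R) `^ p)%:E)%E.
  by move=> _; rewrite lee_fin powR_ge0.
rewrite /empirical ge0_integral_mscale //= ge0_integral_measure_sum //.
have dE (i : 'I_n) :
    (\int[(\d_(nth 0%R theta i : measurableTypeR R))]_u ((u : R) `^ p)%:E =
     (tnth theta i `^ p)%:E)%E.
  by rewrite integral_dirac //= diracT mul1e -tnth_nth.
rewrite (eq_bigr _ (fun i _ => dE i)).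
rewrite sumEFin lee_fin mulrC ler_pdivrMr ?ltr0n //.
by rewrite mulrC.
Qed.

End empirical_measure.

(** * Moment classes and the theorem *)

Section moment_gap.
Variables (R : realType) (n : nat) (p C0 : R).
Hypotheses (n2 : (2 <= n)%N) (p1 : 1 <= p) (C00 : 0 < C0).

Definition moment_const : R :=
  local_const R * expR (3 / 2 * ln p) + 4 * (16 * 24) * (2 * C0) +
  2 * (64 * (22 * (1 + C0) ^+ 2)) * expR 3.

(** The threshold [h0] is p (n^2 ln n)^(1 / (2p + 1)): with it (h0 ln n)^(3/2) is,
    up to a constant, the announced rate, and the parameters above it, whose sum is
    at most n C0 / h0^(p-1), contribute less.  The factor [p] ensures
    [ln n <= h0].  All quantities are written as exponentials of linear
    combinations of ln n and ln (ln n). *)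
Lemma moment_gap (theta : n.-tuple R) (d : estimator R n) :
  moment_params p C0 theta -> perm_invariant d ->
  (mse theta (coordinatewise (sep_rule theta)) <= mse theta d +
    (moment_const * n%:R `^ (3 / (2 * p + 1)) *
       ln n%:R `^ (3 * (p + 1) / (2 * p + 1)))%:E)%E.
Proof.
move=> theta_p dPI; have [theta0 _] := theta_p.
have sum_p := moment_params_sum (ltnW n2) theta_p.
have N0 : 0 < n%:R :> R by rewrite ltr0n ltnW.
have N1 : 1 <= n%:R :> R by rewrite ler1n ltnW.
have L2 := half_le_ln R n2; set L := ln _ in L2 *.
have L0 : 0 < L by lra.
pose q := 2 * p + 1.
have q0 : 0 < q by rewrite /q; have := p1; lra.
pose mu := ln p.
have mu0 : 0 <= mu by exact: ln_ge0.
pose la := ln L.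
have LE : expR la = L by rewrite lnK ?posrE.
have NE : expR L = n%:R by rewrite lnK ?posrE.
have pE : expR mu = p by rewrite lnK ?posrE //; have := p1; lra.
pose e0 := (2 * L + la) / q.
pose TT := expR ((3 * L + 3 * (p + 1) * la) / q).
have TTE : n%:R `^ (3 / (2 * p + 1)) * L `^ (3 * (p + 1) / (2 * p + 1)) = TT.
  rewrite /powR !gt_eqF // -/L -/la -/q -expRD; congr expR; field.
  by rewrite gt_eqF.
rewrite -mulrA TTE.
pose h0 := expR (mu + e0).
have L_h0 : L <= h0.
  rewrite -LE ler_expR /e0 -lerBlDl ler_pdivlMr // /q.
  have : p * (la - mu) <= L.
    have := expR_ge1Dx (la - mu); rewrite expRD expRN LE pE.
    rewrite ler_pdivlMr ?(lt_le_trans ltr01) // => h.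
    by have := p1; nra.
  by have := p1; nra.
have inv_L : expR (- la) <= 2.
  rewrite expRN LE -[leRHS]invrK lef_pV2 ?posrE //.
have la1 : -1 <= la by have := expR_ge1Dx (- la); lra.
have TT3 : 1 <= expR 3 * TT.
  rewrite -expRD -[leLHS]expR0 ler_expR -lerBlDl ler_pdivlMr //.
  have : 0 <= (p + 1) * (la + 1) by have := p1; move=> ?; rewrite mulr_ge0 //; lra.
  by have := p1; rewrite /q; lra.
have theta_le i : tnth theta i <= (1 + C0) * n%:R ^+ 2.
  have th_p : tnth theta i `^ p <= n%:R * C0.
    apply: le_trans sum_p; rewrite (bigD1 i) //= lerDl.
    by apply: sumr_ge0 => j _; exact: powR_ge0.
  apply: (@le_trans _ _ (1 + tnth theta i `^ p)).
    have [t1|t1] := leP (tnth theta i) 1.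
      by apply: (le_trans t1); rewrite lerDl powR_ge0.
    apply: (@le_trans _ _ (tnth theta i `^ p)); last by rewrite lerDr.
    by rewrite -{1}(powRr1 (theta0 i)) ler_powR // ltW.
  have NN : n%:R <= n%:R ^+ 2 :> R by rewrite expr2 ler_peMl // ltW.
  have : n%:R * C0 <= n%:R ^+ 2 * C0 by rewrite ler_wpM2r // ltW.
  by lra.
have tail : \sum_i (if h0 < tnth theta i then tnth theta i else 0) <=
    n%:R * C0 * expR (- ((p - 1) * (mu + e0))).
  apply: (@le_trans _ _ (\sum_i tnth theta i `^ p * expR (- ((p - 1) * (mu + e0))))).
    apply: ler_sum => i _; case: ifPn => [ht|_]; last first.
      by rewrite mulr_ge0 ?powR_ge0 ?expR_ge0.
    have t0 : 0 < tnth theta i by apply: le_lt_trans ht; exact: expR_ge0.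
    rewrite /powR gt_eqF // -expRD -{1}(lnK t0) ler_expR.
    have : mu + e0 <= ln (tnth theta i).
      by rewrite -ler_expR (lnK t0) ltW.
    by have := p1; nra.
  by rewrite -mulr_suml ler_wpM2r ?expR_ge0.
have tail_TT : L * \sum_i (if h0 < tnth theta i then tnth theta i else 0) <=
    2 * C0 * TT.
  apply: (@le_trans _ _ (L * (n%:R * C0 * expR (- ((p - 1) * (mu + e0)))))).
    by rewrite ler_wpM2l // ltW.
  apply: (@le_trans _ _ (C0 * (TT * expR (- la)))); last first.
    have -> : 2 * C0 * TT = C0 * (TT * 2) by ring.
    by rewrite ler_wpM2l ?(ltW C00) // ler_wpM2l ?expR_ge0.
  rewrite -{1}LE -{1}NE.
  have -> : expR la * (expR L * C0 * expR (- ((p - 1) * (mu + e0)))) =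
     C0 * (expR la * expR L * expR (- ((p - 1) * (mu + e0)))) by ring.
  rewrite ler_wpM2l ?(ltW C00) // -!expRD ler_expR.
  have -> : (3 * L + 3 * (p + 1) * la) / q - la = la + L - (p - 1) * e0.
    by rewrite /e0 /q; field; rewrite gt_eqF.
  by have := p1; nra.
have main_TT : L * h0 * Num.sqrt (L * h0) = expR (3 / 2 * mu) * TT.
  have -> : L * h0 = expR (la + (mu + e0)) by rewrite expRD LE.
  have -> : Num.sqrt (expR (la + (mu + e0))) = expR ((la + (mu + e0)) / 2).
    rewrite -[RHS]ger0_norm ?expR_ge0 // -sqrtr_sqr -expRM_natl; congr (Num.sqrt (expR _)).
    by field.
  rewrite -!expRD; congr expR; rewrite /e0 /q; field.
  by rewrite gt_eqF.
have budget := gap_budget_local n2 theta0 theta_le L_h0 _ (lexx _).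
apply: le_trans (mse_sep_rule_le_PI theta0 dPI (budget _)) _.
  by rewrite lerDl ltW.
have distr (x y z t : R) : (x + y + z) * t = x * t + y * t + z * t by ring.
rewrite leeD2l // lee_fin -/L main_TT /moment_const distr.
apply: lerD; first apply: lerD.
- by rewrite mulrA.
- rewrite -!mulrA ler_wpM2l // ler_wpM2l // ler_wpM2l // mulrA.
  exact: tail_TT.
- rewrite -[leRHS]mulrA ler_peMr //.
  by rewrite mulr_ge0 // mulr_ge0 // mulr_ge0 // sqr_ge0.
Qed.

End moment_gap.

Theorem theorem1p11 (R : realType) :
  (forall (n : nat) (Theta : set (n.-tuple R)), (2 <= n)%N ->
     Theta `<=` @nonneg_params R n ->
     forall d : estimator R n,
       (tot_reg_S Theta d <= tot_reg_PI Theta d)%E) /\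
  (exists C : R, forall (n : nat) (h : R), (2 <= n)%N -> 0 < h ->
     regret_gap_le (@box_params R n h)
       (C * Num.min (h ^+ 3) ((h * ln n%:R) `^ (3 / 2)))) /\
  (forall s : R, 0 < s ->
     exists C : R, forall n : nat, (2 <= n)%N ->
     regret_gap_le (@subexp_params R n s) (C * ln n%:R ^+ 3)) /\
  (forall p C0 : R, 1 <= p -> 0 < C0 ->
     exists C : R, forall n : nat, (2 <= n)%N ->
     regret_gap_le (@moment_params R n p C0)
       (C * n%:R `^ (3 / (2 * p + 1))
          * ln n%:R `^ (3 * (p + 1) / (2 * p + 1)))).
Proof.
split; first by move=> n Theta _ Theta0 d; exact: tot_reg_S_le_PI.
split.
  exists (local_const R + 16 * (64 * 22)) => n h n2 h0.
  apply: regret_gap_le_oracle => [|theta d theta_h dPI]; first exact: box_params_nonneg.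
  have hL : 0 < h * ln n%:R.
    by rewrite mulr_gt0 // (lt_le_trans _ (half_le_ln R n2)) ?invr_gt0.
  have -> : (h * ln n%:R) `^ (3 / 2) = h * ln n%:R * Num.sqrt (h * ln n%:R).
    have -> : 3 / 2 = 1 + 2^-1 :> R by field.
    rewrite powRD; last by rewrite gt_eqF // implybT.
    by rewrite powRr1 ?powR12_sqrt ?(ltW hL).
  rewrite /Num.min; case: ifP => _; last exact: box_gap_local.
  apply: le_trans (box_gap_cubic h0 theta_h dPI) _.
  rewrite leeD2l // lee_fin ler_wpM2r ?exprn_ge0 ?(ltW h0) //.
  rewrite -[leLHS]add0r lerD ?local_const_ge0 // ler_peMr //.
  by rewrite -natrM ler1n.
split.
  move=> s s0; exists (16 * (2 * s) ^+ 3) => n n2.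
  apply: regret_gap_le_oracle => [theta []//|theta d theta_s dPI].
  have L0 : 0 < ln n%:R :> R.
    by rewrite (lt_le_trans _ (half_le_ln R n2)) ?invr_gt0.
  rewrite -mulrA -exprMn; apply: box_gap_cubic => //.
    by rewrite !mulr_gt0.
  by move=> i; rewrite (subexp_params_le i n2 s0 theta_s) andbT; case: theta_s.
move=> p C0 p1 C00; exists (moment_const p C0) => n n2.
apply: regret_gap_le_oracle => [theta []//|theta d theta_p dPI].
exact: moment_gap.
Qed.
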